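(* Let $T$ be a distal theory, $M\models T$, and let $A\subseteq M$ be small and uniformly stably embedded in $M$, such that $\operatorname{Th}(A_{\operatorname{ind}})$ has dnfcp'. Then $\operatorname{Th}(M,A)$ is $\mathbf{P}$-bounded.
   Context: $T$ is distal if it is NIP and whenever $I+b+J$ is indiscernible with $I,J$ infinite and $I+J$ is indiscernible over a set $B$, then $I+b+J$ is indiscernible over $B$. $(M,A)$ is the expansion of $M$ to $L_{\mathbf{P}}=L\cup\{\mathbf{P}\}$ with $\mathbf{P}(M)=A$; $\operatorname{Th}(M,A)$ is $\mathbf{P}$-bounded if every $L_{\mathbf{P}}$-formula is equivalent modulo it to one of the form $Q_1y_1\in\mathbf{P}\dots Q_ny_n\in\mathbf{P}\,\phi(x,\bar y)$ with $Q_i\in\{\exists,\forall\}$ and $\phi$ an $L$-formula. $A$ is small in $M$ if for every finite tuple $b\in M$ every finitary $L$-type over $A\cup b$ is realized in $M$. $A$ is uniformly stably embedded in $M$ if for every $\phi(x,y)$ there is $\psi(x,z)$ such that for every $c\in M$ there is $b$ from $A$ with $\phi(A,c)=\psi(A,b)$. $A_{\operatorname{ind}}$ is the structure with universe $A$ with a relation $\phi(A)$ for each $L$-formula $\phi(x)$. $M'$ has dnfcp' over $A'\subseteq M'$ if for any $\phi(x,y)$, $\psi(y,z)$ there is $k$ such that for all $b\in M'$, $k$-consistency of $\{\phi(x,c):c\in\psi(A',b)\}$ implies consistency; a theory has dnfcp' if for every $M_1\prec N_1$ of it, $N_1$ has dnfcp' over $M_1$. *)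

(* Defs.v *)
From mathcomp Require Import all_boot all_order.
From mathcomp Require Import boolp classical_sets functions cardinality.

Set Implicit Arguments.
Unset Strict Implicit.
Unset Printing Implicit Defensive.

Local Open Scope classical_set_scope.
Local Open Scope card_scope.

Record language := Language {
  fun_sym : Type;
  farity : fun_sym -> nat;
  rel_sym : Type;
  rarity : rel_sym -> nat
}.

Inductive term (L : language) (V : Type) :=
| Var of V
| App (f : fun_sym L) of 'I_(farity f) -> term L V.
Arguments Var {L V}.
Arguments App {L V}.

(* [formula L V]: first-order formulas with free variables in [V]. The bound
   variable of a quantifier is [None : option V]. A formula phi(x, y) in finite
   tuples x, y is an element of [formula L ('I_n + 'I_m)]; a formula in x with
   parameters from a set [C] is an element of [formula L ('I_n + C)], where each
   parameter is a variable to be interpreted as itself. *)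
Inductive formula (L : language) (V : Type) :=
| Bot
| Eql of term L V & term L V
| Rel (r : rel_sym L) of 'I_(rarity r) -> term L V
| Imp of formula L V & formula L V
| All of formula L (option V).
Arguments Bot {L V}.
Arguments Eql {L V}.
Arguments Rel {L V}.
Arguments Imp {L V}.
Arguments All {L V}.

Definition Neg L (V : Type) (phi : formula L V) := Imp phi Bot.
Definition And L (V : Type) (phi psi : formula L V) := Neg (Imp phi (Neg psi)).
Definition Ex L (V : Type) (phi : formula L (option V)) := Neg (All (Neg phi)).

Record structure (L : language) := Structure {
  carrier :> Type;
  finterp : forall f : fun_sym L, ('I_(farity f) -> carrier) -> carrier;
  rinterp : forall r : rel_sym L, ('I_(rarity r) -> carrier) -> Prop
}.
Arguments finterp {L s}.
Arguments rinterp {L s}.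

Fixpoint eval L (M : structure L) (V : Type) (v : V -> M) (t : term L V) : M :=
  match t with
  | Var x => v x
  | App f ts => finterp f (fun i => eval v (ts i))
  end.

Fixpoint sat L (M : structure L) (V : Type) (v : V -> M)
    (phi : formula L V) : Prop :=
  match phi with
  | Bot => False
  | Eql s t => eval v s = eval v t
  | Rel r ts => rinterp r (fun i => eval v (ts i))
  | Imp p q => sat v p -> sat v q
  | All p => forall x : M, sat (oapp v x) p
  end.

Definition sentence L := formula L void.
Definition theory L := set (sentence L).

Definition holds L (M : structure L) (s : sentence L) := sat (of_void M) s.
Definition models L (M : structure L) (T : theory L) := T `<=` holds M.
Definition Th L (M : structure L) : theory L := holds M.

(* Concatenation of tuples, of assignments, and of sequences. *)
Definition scat (X Y Z : Type) (f : X -> Z) (g : Y -> Z) (s : X + Y) : Z :=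
  match s with inl x => f x | inr y => g y end.

Definition tuple_in (X : Type) n (A : set X) (a : 'I_n -> X) := range a `<=` A.

(* [T] need not be complete: in [nip] and [distal], quantifying over all models
   plays the role of the monster model. *)
Definition nip L (T : theory L) :=
  forall n m (phi : formula L ('I_n + 'I_m)) (M : structure L), models M T ->
  ~ exists (a : nat -> 'I_n -> M) (b : set nat -> 'I_m -> M),
      forall i S, sat (scat (a i) (b S)) phi <-> S i.

Definition sum_lt (X Y : Type) (ltX : X -> X -> Prop) (ltY : Y -> Y -> Prop)
    (s t : X + Y) : Prop :=
  match s, t with
  | inl x, inl x' => ltX x x'
  | inl _, inr _ => True
  | inr _, inl _ => False
  | inr y, inr y' => ltY y y'
  end.

Definition increasing (X : Type) (lt : X -> X -> Prop) k (i : 'I_k -> X) :=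
  forall p q : 'I_k, (p < q)%N -> lt (i p) (i q).

(* Plain indiscernibility is the case [B = set0]. *)
Definition indiscernible L (M : structure L) n (X : Type) (lt : X -> X -> Prop)
    (a : X -> 'I_n -> M) (B : set M) :=
  forall k (phi : formula L ('I_k * 'I_n + set_type B)) (i j : 'I_k -> X),
  increasing lt i -> increasing lt j ->
  sat (scat (fun pq => a (i pq.1) pq.2) (@set_val M B)) phi <->
  sat (scat (fun pq => a (j pq.1) pq.2) (@set_val M B)) phi.

Definition distal L (T : theory L) :=
  nip T /\
  forall (M : structure L), models M T ->
  forall (dI dJ : Order.disp_t) (I : orderType dI) (J : orderType dJ) n
    (a : I -> 'I_n -> M) (b : 'I_n -> M) (c : J -> 'I_n -> M) (B : set M),
  let ltI := fun i i' : I => (i < i')%O : Prop in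
  let ltJ := fun j j' : J => (j < j')%O : Prop in
  let lt1 := fun _ _ : unit => False : Prop in
  let IbJ := scat (scat a (fun _ : unit => b)) c in
  let ltIbJ := sum_lt (sum_lt ltI lt1) ltJ in
  infinite_set [set: I] -> infinite_set [set: J] ->
  indiscernible ltIbJ IbJ set0 ->
  indiscernible (sum_lt ltI ltJ) (scat a c) B ->
  indiscernible ltIbJ IbJ B.

(* A type over [C] is a set of formulas over [C] finitely satisfiable in [M],
   not necessarily maximal. *)
Definition is_type L (M : structure L) n (C : set M)
    (p : set (formula L ('I_n + set_type C))) :=
  forall F, F `<=` p -> finite_set F ->
  exists a : 'I_n -> M, F `<=` sat (scat a (@set_val M C)).

Definition small L (M : structure L) (A : set M) :=
  forall m (b : 'I_m -> M) n
    (p : set (formula L ('I_n + set_type (A `|` range b)))),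
  is_type p ->
  exists a : 'I_n -> M, p `<=` sat (scat a (@set_val M (A `|` range b))).

Definition uniformly_stably_embedded L (M : structure L) (A : set M) :=
  forall n m (phi : formula L ('I_n + 'I_m)),
  exists p (psi : formula L ('I_n + 'I_p)),
  forall c : 'I_m -> M, exists2 b : 'I_p -> M, tuple_in A b &
    forall a : 'I_n -> M, tuple_in A a ->
      (sat (scat a c) phi <-> sat (scat a b) psi).

Definition ind_language (L : language) : language :=
  {| fun_sym := void;
     farity := of_void nat;
     rel_sym := {n : nat & formula L 'I_n};
     rarity := @projT1 nat (fun n => formula L 'I_n) |}.

Definition ind_structure L (M : structure L) (A : set M) :
    structure (ind_language L) :=
  {| carrier := set_type A;
     finterp := fun f : fun_sym (ind_language L) => match f with end;
     rinterp := fun (r : rel_sym (ind_language L)) v =>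
       sat (fun i => set_val (v i)) (projT2 r) |}.

(* The set {phi(x, c) : c in C} of formulas, consistency being with respect to
   the elementary diagram of [M], i.e. finite satisfiability in [M]. *)
Definition consistent L (M : structure L) n m (phi : formula L ('I_n + 'I_m))
    (C : set ('I_m -> M)) :=
  forall F, F `<=` C -> finite_set F ->
  exists a : 'I_n -> M, forall c, F c -> sat (scat a c) phi.

Definition k_consistent k L (M : structure L) n m
    (phi : formula L ('I_n + 'I_m)) (C : set ('I_m -> M)) :=
  forall F, F `<=` C -> F #<= `I_k ->
  exists a : 'I_n -> M, forall c, F c -> sat (scat a c) phi.

Definition dnfcp'_over L (M : structure L) (A : set M) :=
  forall n m p (phi : formula L ('I_n + 'I_m)) (psi : formula L ('I_m + 'I_p)),
  exists k, forall b : 'I_p -> M,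
    let C := [set c | tuple_in A c /\ sat (scat c b) psi] in
    k_consistent k phi C -> consistent phi C.

Definition elementary L (M N : structure L) (f : M -> N) :=
  forall n (phi : formula L 'I_n) (v : 'I_n -> M),
  sat v phi <-> sat (f \o v) phi.

(* An elementary substructure is given as the image of an elementary
   embedding. *)
Definition dnfcp' L (T : theory L) :=
  forall (M N : structure L) (f : M -> N),
  models M T -> models N T -> elementary f -> dnfcp'_over (range f).

Definition pair_language (L : language) : language :=
  {| fun_sym := fun_sym L;
     farity := @farity L;
     rel_sym := option (rel_sym L);
     rarity := oapp (@rarity L) 1 |}.

Definition pair_structure L (M : structure L) (A : set M) :
    structure (pair_language L) :=
  {| carrier := M;
     finterp := fun f : fun_sym (pair_language L) => @finterp L M f;
     rinterp := fun r : rel_sym (pair_language L) =>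
       match r with
       | Some r => @rinterp L M r
       | None => fun v => A (v ord0)
       end |}.

Fixpoint term_lift L (V : Type) (t : term L V) :
    term (pair_language L) V :=
  match t with
  | Var x => Var x
  | App f ts => @App (pair_language L) V f (fun i => term_lift (ts i))
  end.

Fixpoint formula_lift L (V : Type) (phi : formula L V) :
    formula (pair_language L) V :=
  match phi with
  | Bot => Bot
  | Eql s t => Eql (term_lift s) (term_lift t)
  | Rel r ts => @Rel (pair_language L) V (Some r) (fun i => term_lift (ts i))
  | Imp p q => Imp (formula_lift p) (formula_lift q)
  | All p => All (formula_lift p)
  end.

Definition in_P L (V : Type) (t : term (pair_language L) V) :
    formula (pair_language L) V :=
  @Rel (pair_language L) V None (fun=> t).

(* Q_1 y_1 in P ... Q_n y_n in P, phi, with phi an [L]-formula. *)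
Inductive P_bounded_formula L :
    forall V : Type, formula (pair_language L) V -> Prop :=
| Pb_base (V : Type) (phi : formula L V) : P_bounded_formula (formula_lift phi)
| Pb_ex (V : Type) (phi : formula (pair_language L) (option V)) :
    P_bounded_formula phi ->
    P_bounded_formula (Ex (And (in_P (Var None)) phi))
| Pb_all (V : Type) (phi : formula (pair_language L) (option V)) :
    P_bounded_formula phi ->
    P_bounded_formula (All (Imp (in_P (Var None)) phi)).

Definition equivalent_mod L (T : theory L) (V : Type)
    (phi psi : formula L V) :=
  forall (M : structure L), models M T ->
  forall v : V -> M, sat v phi <-> sat v psi.

Definition P_bounded L (T : theory (pair_language L)) :=
  forall n (phi : formula (pair_language L) 'I_n),
  exists2 psi : formula (pair_language L) 'I_n,
    P_bounded_formula psi & equivalent_mod T phi psi.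

(* Main.v *)
Require Import Defs.
From mathcomp Require Import all_boot all_order.
From mathcomp Require Import boolp classical_sets functions cardinality.
From mathcomp Require Import filter.

(* It suffices to eliminate one quantifier "exists x" in M in front of a bounded
   formula. Uniform stable embeddedness replaces the trace on A of the matrix by
   a formula over A, which reduces the problem to bounding
     exists x, forall alpha in A, Phi(v, x, alpha).
   In a distal theory any tuple c has a strong honest definition: there is a
   formula theta such that for every finite set of alpha in A with Phi(c, alpha)
   some theta(x, d), d in A, is satisfied by c and implies all these
   Phi(x, alpha). Otherwise there is an ultrafilter on tuples of A without large
   set admitting such a theta, and its Morley sequences yield, by compactness, an
   indiscernible I + b + J with I + J indiscernible over c, but with Phi(c, .)
   true on I and false at b. The existence of d for a finite set of alpha is a
   consistency statement in A_ind, so by dnfcp' it need only be asserted for sets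
   of some size k depending only on theta, and this is a bounded formula. An
   ultrapower of (M, A) shows that finitely many theta suffice. By smallness,
   consistency of all the Phi(v, x, alpha) gives x in M. *)

Set Implicit Arguments.
Unset Strict Implicit.
Unset Printing Implicit Defensive.

Local Open Scope classical_set_scope.

(** * Formulas *)

Lemma scat_comp (X Y Z W : Type) (f : X -> Z) (g : Y -> Z) (h : Z -> W) :
  h \o scat f g = scat (h \o f) (h \o g).
Proof. by apply: funext; case. Qed.

Lemma sat_ext L (M : structure L) (V : Type) (v w : V -> M) phi :
  v =1 w -> sat v phi <-> sat w phi.
Proof. by move=> /funext ->. Qed.

Fixpoint rename_term L (V W : Type) (f : V -> W) (t : term L V) : term L W :=
  match t with
  | Var x => Var (f x)
  | App g ts => App g (fun i => rename_term f (ts i))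
  end.

Fixpoint rename L (V W : Type) (f : V -> W) (phi : formula L V) : formula L W :=
  match phi with
  | Bot => Bot
  | Eql s t => Eql (rename_term f s) (rename_term f t)
  | Rel r ts => Rel r (fun i => rename_term f (ts i))
  | Imp p q => Imp (rename f p) (rename f q)
  | All p => All (rename (omap f) p)
  end.

Lemma eval_rename L (M : structure L) (V W : Type) (f : V -> W) (v : W -> M) t :
  eval v (rename_term f t) = eval (v \o f) t.
Proof.
elim: t => //= g ts IH; congr finterp.
by apply: funext => i; rewrite IH.
Qed.

Lemma sat_rename L (M : structure L) (V W : Type) (f : V -> W) (v : W -> M) phi :
  sat v (rename f phi) <-> sat (v \o f) phi.
Proof.
elim: phi W f v => //=.
- by move=> {}V s t W f v; rewrite !eval_rename.
- move=> {}V r ts W f v.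
  suff -> : (fun i => eval v (rename_term f (ts i))) =
            (fun i => eval (v \o f) (ts i)) by [].
  by apply: funext => i; rewrite eval_rename.
- by move=> {}V p IHp q IHq W f v; rewrite IHp IHq.
- move=> {}V p IH W f v; split=> H x.
  + by move: (H x); rewrite IH; apply: iffLR; apply: sat_ext; case.
  + by rewrite IH; move: (H x); apply: iffLR; apply: sat_ext; case.
Qed.

Lemma sat_Neg L (M : structure L) (V : Type) (v : V -> M) p :
  sat v (Neg p) <-> ~ sat v p.
Proof. by []. Qed.

Lemma sat_And L (M : structure L) (V : Type) (v : V -> M) p q :
  sat v (And p q) <-> sat v p /\ sat v q.
Proof.
split=> /= [H|[Hp Hq] H]; last exact: H.
split; apply: contrapT => nH; apply: H => Hp Hq; exact: nH.
Qed.

Lemma sat_Ex L (M : structure L) (V : Type) (v : V -> M) p :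
  sat v (Ex p) <-> exists x, sat (oapp v x) p.
Proof.
split=> /= [H|[x Hx] H]; last exact: H Hx.
by apply: contrapT => nH; apply: H => x Hx; apply: nH; exists x.
Qed.

Definition Iff L (V : Type) (p q : formula L V) := And (Imp p q) (Imp q p).

Lemma sat_Iff L (M : structure L) (V : Type) (v : V -> M) p q :
  sat v (Iff p q) <-> (sat v p <-> sat v q).
Proof. by rewrite sat_And. Qed.

Fixpoint AndI L (V : Type) k : ('I_k -> formula L V) -> formula L V :=
  match k with
  | 0 => fun=> Neg Bot
  | k'.+1 => fun p => And (p ord0) (AndI (fun i => p (lift ord0 i)))
  end.

Lemma forall_ordS k (P : 'I_k.+1 -> Prop) :
  (forall i, P i) <-> P ord0 /\ forall i, P (lift ord0 i).
Proof.
split=> [H|[H0 H] i]; first by split.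
by case: (unliftP ord0 i) => [j|] ->.
Qed.

Lemma sat_AndI L (M : structure L) (V : Type) (v : V -> M) k
    (p : 'I_k -> formula L V) :
  sat v (AndI p) <-> forall i, sat v (p i).
Proof.
elim: k p => [|k IH] p /=; first by split=> // _ [].
by rewrite forall_ordS -IH; exact: (sat_And v (p ord0)).
Qed.

Definition ocons (X : Type) k (x : X) (w : 'I_k -> X) (i : 'I_k.+1) :=
  oapp w x (unlift ord0 i).

Lemma ocons0 (X : Type) k (x : X) (w : 'I_k -> X) : ocons x w ord0 = x.
Proof. by rewrite /ocons unlift_none. Qed.

Lemma oconsS (X : Type) k (x : X) (w : 'I_k -> X) i :
  ocons x w (lift ord0 i) = w i.
Proof. by rewrite /ocons liftK. Qed.

Lemma oconsE (X : Type) k (w : 'I_k.+1 -> X) :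
  w = ocons (w ord0) (fun i => w (lift ord0 i)).
Proof.
by apply: funext => i; case: (unliftP ord0 i) => [j|] ->; rewrite ?ocons0 ?oconsS.
Qed.

Definition shift_block (V : Type) k (s : 'I_k.+1 + V) : 'I_k + option V :=
  match s with
  | inl i => if unlift ord0 i is Some j then inl j else inr None
  | inr v => inr (Some v)
  end.

Lemma scat_shift_block (X V : Type) k (w : 'I_k -> X) (v : V -> X) (x : X) :
  scat w (oapp v x) \o @shift_block V k = scat (ocons x w) v.
Proof.
apply: funext => -[i|z] //=.
by rewrite /ocons; case: (unlift ord0 i).
Qed.

Fixpoint AllI L (V : Type) k : formula L ('I_k + V) -> formula L V :=
  match k with
  | 0 => rename (scat (fun i : 'I_0 => match notF (ltn_ord i) with end) id)
  | k'.+1 => fun p => All (AllI (rename (@shift_block V k') p))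
  end.

Lemma sat_AllI L (M : structure L) (V : Type) (v : V -> M) k
    (p : formula L ('I_k + V)) :
  sat v (AllI p) <-> forall w, sat (scat w v) p.
Proof.
elim: k V v p => [|k IH] V v p.
  rewrite sat_rename scat_comp.
  split=> [H w|/(_ (fun i : 'I_0 => v (match notF (ltn_ord i) with end)))].
    by apply: iffLR H; apply: sat_ext => -[[]|].
  by apply: iffLR; apply: sat_ext => -[[]|].
split=> /= [H w|H x].
  have /IH/(_ (fun i => w (lift ord0 i))) := H (w ord0).
  by rewrite sat_rename scat_shift_block -oconsE.
by apply/IH => w; rewrite sat_rename scat_shift_block.
Qed.

Definition AllF L (V : Type) (Z : finType) (p : formula L (Z + V)) : formula L V :=
  AllI (rename (scat (inl \o @enum_rank Z) inr) p).

Lemma sat_AllF L (M : structure L) (V : Type) (v : V -> M) (Z : finType)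
    (p : formula L (Z + V)) :
  sat v (AllF p) <-> forall w, sat (scat w v) p.
Proof.
rewrite sat_AllI; split=> H w.
  move: (H (w \o enum_val)); rewrite sat_rename; apply: iffLR; apply: sat_ext.
  by case=> //= z; rewrite enum_rankK.
rewrite sat_rename scat_comp; exact: (H (w \o enum_rank)).
Qed.

Lemma eval_bounded L (V : Type) (h : V -> nat) (t : term L V) :
  exists p, forall (M : structure L) (v w : V -> M),
    (forall z, (h z < p)%N -> v z = w z) -> eval v t = eval w t.
Proof.
elim: t => [x|f ts IH]; first by exists (h x).+1 => M v w /(_ x (ltnSn _)).
have /choice[p Hp] := IH.
exists (\max_i p i) => M v w H /=; congr finterp; apply: funext => i.
by apply: Hp => z hz; apply: H; apply: leq_trans hz _; exact: (leq_bigmax i).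
Qed.

(** Only finitely many variables occur in a formula, so their ranks under [h] are bounded. A rank in
    place of a list of variables lets the induction pass to [option V]. *)
Lemma sat_bounded L (V : Type) (h : V -> nat) (phi : formula L V) :
  exists p, forall (M : structure L) (v w : V -> M),
    (forall z, (h z < p)%N -> v z = w z) -> sat v phi <-> sat w phi.
Proof.
elim: phi h => {V} [V|V s t|V r ts|V p IHp q IHq|V p IH] h.
- by exists 0.
- have [[p Hp] [q Hq]] := (eval_bounded h s, eval_bounded h t).
  exists (maxn p q) => M v w H /=; rewrite (Hp _ v w) ?(Hq _ v w) // => z hz;
  by apply: H; rewrite leq_max hz ?orbT.
- have /choice[p Hp] := fun i => eval_bounded h (ts i).
  exists (\max_i p i) => M v w H /=.
  suff -> : (fun i => eval v (ts i)) = (fun i => eval w (ts i)) by [].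
  apply: funext => i; apply: Hp => z hz; apply: H.
  by apply: leq_trans hz _; exact: (leq_bigmax i).
- have [[m Hm] [n Hn]] := (IHp h, IHq h).
  exists (maxn m n) => M v w H /=; rewrite (Hm _ v w) ?(Hn _ v w) // => z hz;
  by apply: H; rewrite leq_max hz ?orbT.
(* The rank 0 of the bound variable is arbitrary, as both assignments give it the same value. *)
- have [m Hm] := IH (oapp h 0).
  exists m => M v w H /=.
  have E x : sat (oapp v x) p <-> sat (oapp w x) p.
    by apply: Hm => -[z|] //= /H.
  by split=> Hx x; apply/E.
Qed.

(** The variables of [Z] that matter have codes below a bound. A code of no element of [Z] gets the
    value [x0]; recording this keeps [d'] inside any set containing [x0] and all [d z]. *)
Lemma finite_support L (X : Type) (Z : countType) (theta : formula L (X + Z)) :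
  exists p (theta' : formula L (X + 'I_p)),
  forall (M : structure L) (x0 : M) (d : Z -> M),
  exists d' : 'I_p -> M,
    (forall i, d' i = x0 \/ exists z, d' i = d z) /\
    forall x, sat (scat x d') theta' <-> sat (scat x d) theta.
Proof.
have [p Hp] := sat_bounded (scat (fun=> 0) pickle) theta.
(* The successor provides the nonempty ordinal type that [inord] requires. *)
exists p.+1, (rename (scat inl (inr \o inord \o pickle)) theta) => M x0 d.
exists (fun i => oapp d x0 (unpickle i)); split=> [i|x].
  by case: unpickle => [z|]; [right; exists z|left].
rewrite sat_rename; apply: Hp => -[u|z] //= hz.
by rewrite inordK ?pickleK // ltnW.
Qed.

(** * Ultrapowers and compactness *)

Section UltrafilterFacts.
Variables (I : Type) (U : set_system I).
Hypothesis UU : UltraFilter U.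

Lemma ultraC P : U (~` P) <-> ~ U P.
Proof.
split=> [UnP UP|nUP].
  have : U set0 by rewrite -(setICr P); exact: filterI.
  exact: filter_not_empty.
by case: (in_ultra_setVsetC P UU).
Qed.

Lemma ultra_forall k (P : 'I_k -> set I) :
  (forall j, U (P j)) -> U [set x | forall j, P j x].
Proof.
elim: k P => [|k IH] P HP; first by apply: filterS filterT => x _ [].
apply: filterS (filterI (HP ord0) (IH _ (fun j => HP (lift ord0 j)))) => x [H0 H].
exact/forall_ordS.
Qed.

Lemma ultra_ex P : U P -> exists x, P x.
Proof. exact: filter_ex. Qed.

Lemma ultra_imp (P Q : set I) : U [set x | P x -> Q x] <-> (U P -> U Q).
Proof.
split=> [UPQ UP|H]; first by apply: filterS (filterI UPQ UP) => x [PQ /PQ].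
have [/H UQ|nUP] := pselect (U P).
  by apply: filterS UQ => x Qx.
have UnP := (ultraC P).2 nUP.
by apply: filterS UnP => x nP /= /nP.
Qed.

End UltrafilterFacts.

Lemma ultra_of_fip (I J : Type) (B : J -> set I) :
  (forall k (s : 'I_k -> J), exists x, forall i, B (s i) x) ->
  exists2 U : set_system I, UltraFilter U & forall j, U (B j).
Proof.
move=> fip.
pose F := [set S : set I | exists k (s : 'I_k -> J),
  [set x | forall i, B (s i) x] `<=` S].
have FF : ProperFilter F.
  split=> [[k [s H]]|]; first by have [x /H] := fip k s.
  split.
  - by exists 0, (fun i : 'I_0 => match notF (ltn_ord i) with end).
  - move=> P Q [k [s Hs]] [l [t Ht]].
    exists (k + l)%N, (fun i => scat s t (fintype.split i)) => x H; split.
      by apply: Hs => i; move: (H (lshift l i)); rewrite (unsplitK (inl i)).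
    by apply: Ht => i; move: (H (rshift k i)); rewrite (unsplitK (inr i)).
  - by move=> P Q PQ [k [s Hs]]; exists k, s; exact: subset_trans PQ.
have [U [UU FU]] := ultraFilterLemma FF.
by exists U => // j; apply: FU; exists 1, (fun=> j) => x /(_ ord0).
Qed.

Section Ultrapower.
Variables (L : language) (M : structure L) (I : Type) (W : set_system I).
Hypothesis WW : UltraFilter W.

(** The quotient of [I -> M] by equality on a member of [W], its elements being the equivalence
    classes. *)
Definition ucarrier := {P : set (I -> M) |
  exists f, P = [set g | W [set i | f i = g i]]}.

Definition uclass (f : I -> M) : ucarrier :=
  exist _ [set g | W [set i | f i = g i]] (ex_intro _ f erefl).

Definition urepr (x : ucarrier) : I -> M := sval (cid (svalP x)).

Lemma uclassP f g : uclass f = uclass g <-> W [set i | f i = g i].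
Proof.
split=> [[/(congr1 (fun P : set _ => P g)) /= ->]|fg].
  by apply: filterS filterT.
apply: eq_exist; apply/seteqP; split=> h /= H.
  by apply: filterS (filterI fg H) => i [/= ->].
by apply: filterS (filterI fg H) => i [/= ->].
Qed.

Lemma ureprK x : uclass (urepr x) = x.
Proof.
by case: x => P HP; apply: eq_exist; rewrite /urepr; case: cid.
Qed.

Lemma urepr_class f : W [set i | urepr (uclass f) i = f i].
Proof. by apply/uclassP; rewrite ureprK. Qed.

Definition ultrapower : structure L :=
  {| carrier := ucarrier;
     finterp := fun f v => uclass (fun i => finterp f (fun j => urepr (v j) i));
     rinterp := fun r v => W [set i | rinterp r (fun j => urepr (v j) i)] |}.

Lemma eval_ultrapower (V : Type) (v : V -> I -> M) t :
  eval (M := ultrapower) (fun x => uclass (v x)) t =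
  uclass (fun i => eval (v^~ i) t).
Proof.
elim: t => //= f ts IH; apply/uclassP.
have H := ultra_forall WW (fun j => urepr_class (fun i => eval (v^~ i) (ts j))).
apply: filterS H => i H; congr finterp; apply: funext => j.
by rewrite IH H.
Qed.

(** Łoś's theorem. *)
Lemma sat_ultrapower (V : Type) (v : V -> I -> M) phi :
  sat (M := ultrapower) (fun x => uclass (v x)) phi <->
  W [set i | sat (v^~ i) phi].
Proof.
elim: phi v => {V} [V|V s t|V r ts|V p IHp q IHq|V p IH] v /=.
- by split=> // /filter_not_empty.
- by rewrite !eval_ultrapower uclassP.
- have H := ultra_forall WW (fun j => urepr_class (fun i => eval (v^~ i) (ts j))).
  have E : [set i | forall j, urepr (uclass (fun i => eval (v^~ i) (ts j))) i =
              eval (v^~ i) (ts j)] `<=`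
      [set i | rinterp r (fun j => urepr (eval (M := ultrapower)
                 (fun x => uclass (v x)) (ts j)) i) <->
               rinterp r (fun j => eval (v^~ i) (ts j))].
    move=> i Hi /=; suff -> : (fun j => urepr (eval (M := ultrapower)
      (fun x => uclass (v x)) (ts j)) i) = (fun j => eval (v^~ i) (ts j)) by [].
    by apply: funext => j; rewrite eval_ultrapower Hi.
  split=> H'; apply: filterS (filterI H H') => i [/E /= Ei]; by rewrite Ei.
- by rewrite IHp IHq -ultra_imp.
- pose w (x : I -> M) := oapp v x.
  have Ew x : oapp (fun x => uclass (v x)) (uclass x) = (fun z => uclass (w x z)).
    by apply: funext => -[].
  have Ei x i : (fun z => w x z i) = oapp (v^~ i) (x i) by apply: funext => -[].
  split=> [H|H x]; last first.
    rewrite -[x]ureprK Ew IH; apply: filterS H => i /= H.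
    by rewrite Ei.
  apply: contrapT => /(ultraC WW) nH.
  (* A counterexample is chosen at each index that has one; together they represent an element of
     the ultrapower. *)
  have /choice[x Hx] : forall i, exists x, ~ (forall x, sat (oapp (v^~ i) x) p) ->
      ~ sat (oapp (v^~ i) x) p.
    move=> i; have [/existsNP[x Hx]|H'] :=
      pselect (~ forall x, sat (oapp (v^~ i) x) p); first by exists x.
    (* Elsewhere any element of [M] will do, and an index with a counterexample supplies one. *)
    have [f _] := ultra_ex WW nH.
    have [_ /existsNP[x _]] := ultra_ex WW nH.
    by exists x.
  have := H (uclass x); rewrite Ew IH => Wx.
  have [i [/= nHi]] := ultra_ex WW (filterI nH Wx).
  by rewrite Ei; exact: Hx.
Qed.

Lemma holds_ultrapower s : holds M s -> holds ultrapower s.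
Proof.
move=> Hs; have := sat_ultrapower (of_void (I -> M)) s.
rewrite /holds (_ : (fun x => _) = of_void _); last by apply: funext => -[].
move=> ->; apply: filterS filterT => i _ /=.
by rewrite (_ : (fun x => _) = of_void _) //; apply: funext => -[].
Qed.

End Ultrapower.

(** The ultrapower is indexed by the assignments [V -> M], with an ultrafilter that makes almost all
    of them satisfy each formula of [Gamma]. A variable is interpreted by its evaluation map. *)
Lemma compactness L (M : structure L) (V : Type) (Gamma : set (formula L V)) :
  (forall k (s : 'I_k -> formula L V), (forall i, Gamma (s i)) ->
     exists v : V -> M, forall i, sat v (s i)) ->
  exists (N : structure L) (v : V -> N),
    (forall s, holds M s -> holds N s) /\ Gamma `<=` sat v.
Proof.
move=> fin_sat.
have [k s|W WW WG] := @ultra_of_fip (V -> M) {phi | Gamma phi}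
    (fun phi => [set v | sat v (sval phi)]).
  have [v Hv] := fin_sat k (sval \o s) (fun i => svalP (s i)).
  by exists v.
exists (ultrapower M W), (fun x => uclass W (fun v => v x)).
split=> [s|phi Gphi]; first exact: holds_ultrapower.
exact/sat_ultrapower/(WG (exist _ phi Gphi)).
Qed.

(** * Iterated ultrafilter quantifiers *)

Definition upd (Y : Type) (g : nat -> Y) n (y : Y) :=
  fun i => if i == n then y else g i.

Lemma updE (Y : Type) (g : nat -> Y) n y : upd g n y n = y.
Proof. by rewrite /upd eqxx. Qed.

Lemma upd_neq (Y : Type) (g : nat -> Y) n y i : i != n -> upd g n y i = g i.
Proof. by rewrite /upd => /negbTE ->. Qed.

Lemma upd_in (Y : Type) (X : set Y) (g : nat -> Y) n y :
  (forall i, X (g i)) -> X y -> forall i, X (upd g n y i).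
Proof. by move=> Xg Xy i; rewrite /upd; case: eqP. Qed.

Section IteratedUltrafilter.
Variables (Y : Type) (U : set_system Y).
Hypothesis UU : UltraFilter U.

(* "For [U]-many y_(n-1), ..., for [U]-many y_0, P": the largest index is
   quantified outermost, and entries of index at least [n] are those of [g]. *)
Fixpoint itU (g : nat -> Y) n (P : (nat -> Y) -> Prop) : Prop :=
  match n with
  | 0 => P g
  | n'.+1 => U [set y | itU (upd g n' y) n' P]
  end.

Lemma itU_mono_in (X : set Y) g n (P Q : (nat -> Y) -> Prop) :
  U X -> (forall i, X (g i)) ->
  (forall f, (forall i, X (f i)) -> (forall i, (n <= i)%N -> f i = g i) ->
     P f -> Q f) ->
  itU g n P -> itU g n Q.
Proof.
move=> UX; elim: n g => [|n IH] g Xg PQ /=; first exact: PQ.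
move=> H; apply: filterS (filterI H UX) => y /= [H' Xy].
apply: IH H' => [|f Xf fg]; first exact: upd_in.
apply: PQ => // i ni; rewrite fg ?(ltnW ni) // upd_neq //.
by rewrite gtn_eqF.
Qed.

Lemma itU_mono g n (P Q : (nat -> Y) -> Prop) :
  (forall f, (forall i, (n <= i)%N -> f i = g i) -> P f -> Q f) ->
  itU g n P -> itU g n Q.
Proof.
move=> PQ; apply: (@itU_mono_in setT) => // [|f _]; [exact: filterT|exact: PQ].
Qed.

Lemma itU_ext g n (P Q : (nat -> Y) -> Prop) :
  (forall f, (forall i, (n <= i)%N -> f i = g i) -> P f <-> Q f) ->
  itU g n P <-> itU g n Q.
Proof. by move=> PQ; split; apply: itU_mono => f /PQ []. Qed.

Lemma ultra_ext (P Q : set Y) : (forall y, P y <-> Q y) -> U P <-> U Q.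
Proof. by move=> PQ; split; apply: filterS => y /PQ. Qed.

Lemma itU_true g n P : (forall f, P f) -> itU g n P.
Proof.
move=> HP; elim: n g => [|n IH] g //=.
by apply: filterS filterT => y _; exact: IH.
Qed.

Lemma itU_true_in (X : set Y) g n P : U X -> (forall i, X (g i)) ->
  (forall f, (forall i, X (f i)) -> P f) -> itU g n P.
Proof.
move=> UX Xg HP; apply: (@itU_mono_in X g n (fun=> True)) => //.
  by move=> f Xf _ _; exact: HP.
exact: itU_true.
Qed.

Lemma itU_imp g n P Q :
  itU g n (fun f => P f -> Q f) <-> (itU g n P -> itU g n Q).
Proof.
elim: n g => //= n IH g; rewrite -ultra_imp.
by apply: ultra_ext => y; exact: IH.
Qed.

Lemma itU_const g n (Q : Prop) : itU g n (fun=> Q) <-> Q.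
Proof.
split=> [|HQ]; last exact: itU_true.
by elim: n g => //= n IH g /(ultra_ex UU)[y]; exact: IH.
Qed.

Lemma itU_forall g n k (P : 'I_k -> (nat -> Y) -> Prop) :
  (forall j, itU g n (P j)) -> itU g n (fun f => forall j, P j f).
Proof.
elim: n g => //= n IH g H.
by apply: filterS (ultra_forall UU H) => y; exact: IH.
Qed.

Lemma itU_and g n P Q : itU g n P -> itU g n Q -> itU g n (fun f => P f /\ Q f).
Proof.
move=> HP; apply/itU_imp; move: HP; apply/itU_imp.
by apply: itU_true => f; split.
Qed.

(** Witnesses in [X] are chosen for the [n] outermost quantifiers, those of the largest indices. *)
Lemma itU_pick (X : set Y) g n k P : U X -> (forall i, X (g i)) ->
  itU g (n + k) P -> exists2 g', forall i, X (g' i) & itU g' k P.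
Proof.
move=> UX; elim: n g => [|n IH] g Xg /= H; first by exists g.
have [y [/= Hy Xy]] := ultra_ex UU (filterI H UX).
by apply: IH Hy; exact: upd_in.
Qed.

Lemma itU_witness (X : set Y) g n P : U X -> (forall i, X (g i)) ->
  itU g n P ->
  exists f, [/\ forall i, X (f i), forall i, (n <= i)%N -> f i = g i & P f].
Proof.
move=> UX Xg H.
have [|g' Xg'] := @itU_pick X g n 0
  (fun f => [/\ forall i, X (f i), forall i, (n <= i)%N -> f i = g i & P f]) UX Xg.
  by rewrite addn0; apply: (itU_mono_in UX Xg _ H).
by exists g'.
Qed.

(** The quantifiers change only entries below [n], so fixing entry [k] commutes with them. *)
Lemma itU_upd g n k y P : (n <= k)%N ->
  itU (upd g k y) n P <-> itU g n (fun f => P (upd f k y)).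
Proof.
elim: n g => //= n IH g nk; apply: ultra_ext => z /=.
rewrite -IH ?(ltnW nk) //.
suff -> : upd (upd g k y) n z = upd (upd g n z) k y by [].
apply: funext => i; rewrite /upd; case: (i =P k) => // ->.
by rewrite gtn_eqF.
Qed.

(* An increasing subsequence of a Morley sequence is a Morley sequence. *)
Lemma itU_subseq g h n k (i : nat -> nat) P :
  (forall p q, (p < q < k)%N -> (i p < i q)%N) ->
  (forall p, (p < k)%N -> (i p < n)%N) ->
  itU g n (fun f => P (fun p => if (p < k)%N then f (i p) else h p)) <->
  itU h k P.
Proof.
elim: n g h k => [|n IH] g h k inc bnd.
  by case: k inc bnd => [//|k] _ /(_ 0 isT).
case: k inc bnd => [|k] inc bnd.
  exact: (itU_const g n.+1 (P h)).
have inc' p q : (p < q < k)%N -> (i p < i q)%N.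
  by case/andP=> pq qk; apply: inc; rewrite pq (ltn_trans qk).
(* If the last selected index is [n], the outermost quantifiers of both sides correspond. *)
have [ikn|ikn] := eqVneq (i k) n.
  rewrite /=; apply: ultra_ext => y /=.
  rewrite -(IH (upd g n y)) // => [|p pk]; last first.
    by rewrite -ikn; apply: inc; rewrite pk ltnSn.
  apply: itU_ext => f Hf.
  suff -> : (fun p => if (p < k.+1)%N then f (i p) else h p) =
    (fun p => if (p < k)%N then f (i p) else upd h k y p) by [].
  apply: funext => p; rewrite ltnS leq_eqVlt /upd.
  by case: eqVneq => [->|_] /=; rewrite ?ltnn // ikn Hf // updE.
have bnd' p : (p < k.+1)%N -> (i p < n)%N.
  have ikn' : (i k < n)%N by rewrite ltn_neqAle ikn -ltnS bnd.
  rewrite ltnS leq_eqVlt => /orP[/eqP -> //|pk].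
  by apply: ltn_trans ikn'; apply: inc; rewrite pk ltnSn.
(* Otherwise entry [n] is not selected and the quantifier over it is vacuous. *)
split=> [/(ultra_ex UU)[y Hy]|H].
  exact: (IH (upd g n y) h k.+1 inc bnd').1 Hy.
apply: (@filterS _ U _ setT _ _ filterT) => y _.
exact: (IH (upd g n y) h k.+1 inc bnd').2 H.
Qed.

End IteratedUltrafilter.

(** * Strong honest definitions in distal theories *)

Section Good.
Variables (L : language) (M : structure L) (A : set M).
Variables (X : Type) (m : nat) (Phi : formula L (X + 'I_m)) (a : X -> M).

(* A strong honest definition on [S]: theta depends only on [S], but its
   parameters [d] in [A] may depend on the finite part of [S] considered. *)
Definition good (S : set ('I_m -> M)) : Prop :=
  exists (Z : countType) (theta : formula L (X + Z)),
  forall k (alpha : 'I_k -> 'I_m -> M), (forall j, S (alpha j)) ->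
  exists d : Z -> M, [/\ forall z, A (d z), sat (scat a d) theta &
    forall j x, sat (scat x d) theta -> sat (scat x (alpha j)) Phi].

Lemma good_sub S S' : S `<=` S' -> good S' -> good S.
Proof.
by move=> SS' [Z [theta H]]; exists Z, theta => k alpha Ha; apply: H => j; exact: SS'.
Qed.

Lemma good0 : good set0.
Proof.
exists void, (Neg Bot) => k alpha Ha; exists (of_void M); split=> //.
by move=> j; have := Ha j.
Qed.

Lemma subfamily (Y : Type) k (alpha : 'I_k -> Y) (S : set Y) :
  exists l (beta : 'I_l -> Y), (forall j, S (beta j)) /\
    forall j, S (alpha j) -> exists j', beta j' = alpha j.
Proof.
pose B := [set j | `[< S (alpha j) >]]%SET.
exists #|B|, (fun j => alpha (enum_val j)); split=> [j|j Sj].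
  by have := enum_valP j; rewrite inE => /asboolP.
have jB : j \in B by rewrite inE; apply/asboolP.
by exists (enum_rank_in jB j); rewrite enum_rankK_in.
Qed.

(** The conjunction of the two formulas, with separate parameters, serves a finite family divided
    between [S1] and [S2]. *)
Lemma goodU S1 S2 : good S1 -> good S2 -> good (S1 `|` S2).
Proof.
move=> [Z1 [t1 H1]] [Z2 [t2 H2]].
exists (Z1 + Z2)%type, (And (rename (scat inl (inr \o inl)) t1)
                            (rename (scat inl (inr \o inr)) t2)).
move=> k alpha Ha.
have [k1 [alpha1 [/H1[d1 [Ad1 ad1 D1]] E1]]] := subfamily alpha S1.
have [k2 [alpha2 [/H2[d2 [Ad2 ad2 D2]] E2]]] := subfamily alpha S2.
exists (scat d1 d2); split.
- by case.
- by rewrite sat_And !sat_rename !scat_comp.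
- move=> j x; rewrite sat_And !sat_rename !scat_comp => -[/D1 H /D2 H'].
  by case: (Ha j) => [/E1[j' <-]|/E2[j' <-]].
Qed.

(** Good sets form an ideal. If it omits [S], the sets [P] with [S] minus [P] good form a proper
    filter, and any ultrafilter extending it works. *)
Lemma not_good_ultra S : ~ good S ->
  exists2 U : set_system ('I_m -> M), UltraFilter U &
    U S /\ forall S', U S' -> ~ good S'.
Proof.
move=> nS; pose F := [set P | good (S `\` P)].
have FF : ProperFilter F.
  split; first by rewrite /F /= setD0.
  split.
  - by rewrite /F /= setDT; exact: good0.
  - by move=> P Q FP FQ; rewrite /F /= setDIr; exact: goodU.
  - by move=> P Q PQ; apply: good_sub; exact: setDS.
have [U [UU FU]] := ultraFilterLemma FF.
exists U => //; split; first by apply: FU; rewrite /F /= setDv; exact: good0.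
move=> S' US' gS'; apply/(ultraC UU): US'; apply: FU.
by apply: good_sub gS' => x [_ /contrapT].
Qed.

End Good.

Section DistalGood.
Variables (L : language) (T : theory L) (M : structure L) (A : set M).
Hypothesis T_distal : distal T.
Hypothesis M_T : models M T.
Variables (X : Type) (m : nat) (Phi : formula L (X + 'I_m)) (a : X -> M).

Let Y := 'I_m -> M.
Let Xa : set Y := [set alpha | (forall q, A (alpha q)) /\ sat (scat a alpha) Phi].

(* The index set of a sequence I + b + J with I = J = omega. *)
Let S := ((nat + unit) + nat)%type.
Let mid : S := inl (inr tt).
Definition emb (z : nat + nat) : S := scat (inl \o inl) inr z.
Definition retr (s : S) : option (nat + nat) :=
  match s with
  | inl (inl i) => Some (inl i)
  | inl (inr _) => None
  | inr j => Some (inr j)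
  end.

(* The truncated sequence occupies positions 0, ..., 2N, with b at N; the
   out-of-range elements of I are sent beyond these. *)
Definition pos N (s : S) : nat :=
  match s with
  | inl (inl i) => if (i < N)%N then i else (N + N.+2)%N
  | inl (inr _) => N
  | inr j => (N.+1 + j)%N
  end.

Lemma pos_emb N z : pos N (emb z) != N.
Proof.
case: z => [i|j] /=.
  case: ifP => [iN|_]; first by rewrite ltn_eqF.
  by rewrite gtn_eqF // addnS ltnS leq_addr.
by rewrite gtn_eqF // leq_addr.
Qed.

Lemma retrK s z : retr s = Some z -> s = emb z.
Proof. by case: s => [[i|u]|j] //= [<-]. Qed.

Lemma retr_None s : retr s = None -> s = mid.
Proof. by case: s => [[i|[]]|j]. Qed.

Section Ultra.
Variable U : set_system Y.
Hypothesis UU : UltraFilter U.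
Hypothesis UXa : U Xa.
Hypothesis U_not_good : forall S', U S' -> ~ good A Phi a S'.
Variable y0 : Y.
Hypothesis Xy0 : Xa y0.

Let g0 : nat -> Y := fun=> y0.
Let V := (X + S * 'I_m)%type.

(** Truth in a Morley sequence of [U], for all large truncations: the entries of J are chosen first,
    then b at position [N], then those of I. *)
Definition ev (P : nat -> (nat -> Y) -> Prop) :=
  exists n, forall N, (n <= N)%N -> itU U g0 (N + N.+1) (P N).

Definition asg (f : nat -> Y) N (z : S * 'I_m) : M := f (pos N z.1) z.2.
Definition asgD (f : nat -> Y) N (z : (nat + nat) * 'I_m) : M :=
  f (pos N (emb z.1)) z.2.
Definition embD (z : (nat + nat) * 'I_m) : S * 'I_m := (emb z.1, z.2).

(** The type of a counterexample to distality. Over [a] only I + J follows the Morley sequence;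
    without [a] all of I + b + J does; and [Phi(a, b)] fails. *)
Inductive EM_type : set (formula L V) :=
| EM_D (delta : formula L (X + (nat + nat) * 'I_m)) :
    ev (fun N f => sat (scat a (asgD f N)) delta) ->
    EM_type (rename (scat inl (inr \o embD)) delta)
| EM_E (eps : formula L (S * 'I_m)) :
    ev (fun N f => sat (asg f N) eps) -> EM_type (rename inr eps)
| EM_b : EM_type (Neg (rename (scat inl (fun q => inr (mid, q))) Phi)).

Lemma ev_true P : (forall N f, P N f) -> ev P.
Proof. by move=> H; exists 0 => N _; exact: itU_true. Qed.

(** I and J come from the Morley sequence, but b cannot, since [Phi(a, .)] holds on a set of [U]. It
    is obtained from the failure of a suitable formula to be a strong honest definition. *)
Lemma EM_type_fin_sat k (s : 'I_k -> formula L V) :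
  (forall i, EM_type (s i)) -> exists v : V -> M, forall i, sat v (s i).
Proof.
move=> Hs.
(* Each formula of the type is covered by a part over [a] not mentioning b, a part not mentioning
   [a], and the failure of [Phi(a, b)]; missing parts are [Neg Bot]. *)
have /choice[p Hp] : forall j, exists p : formula L (X + (nat + nat) * 'I_m) *
    formula L (S * 'I_m),
  [/\ ev (fun N f => sat (scat a (asgD f N)) p.1),
      ev (fun N f => sat (asg f N) p.2) &
      forall (b : Y) (v : S * 'I_m -> M), ~ sat (scat a b) Phi ->
        (fun q => v (mid, q)) = b ->
        sat (scat a (v \o embD)) p.1 -> sat v p.2 -> sat (scat a v) (s j)].
  move=> j; case: (Hs j) => [delta Hd|eps He|].
  - exists (delta, Neg Bot); split=> //; first by apply: ev_true => N f /=.
    by move=> b v _ _; rewrite sat_rename scat_comp.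
  - exists (Neg Bot, eps); split=> //; first by apply: ev_true => N f /=.
    by move=> b v _ _ _; rewrite sat_rename.
  - exists (Neg Bot, Neg Bot); split=> //; try by apply: ev_true => N f /=.
    by move=> b v nb vb _ _; rewrite sat_Neg sat_rename scat_comp /= /comp /= vb.
have /choice[nD HD] : forall j, ev (fun N f => sat (scat a (asgD f N)) (p j).1).
  by move=> j; case: (Hp j).
have /choice[nE HE] : forall j, ev (fun N f => sat (asg f N) (p j).2).
  by move=> j; case: (Hp j).
pose N := maxn (\max_j nD j) (\max_j nE j).
pose E := AndI (fun j => (p j).2).
pose D f := forall j, sat (scat a (asgD f N)) (p j).1.
have : itU U g0 (N + N.+1) (fun f => D f /\ sat (asg f N) E).
  apply: itU_and.
    apply: itU_forall => // j; apply: HD.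
    by rewrite leq_max (leq_bigmax j).
  have := @itU_forall _ _ UU g0 (N + N.+1) k (fun j f => sat (asg f N) (p j).2).
  move=> H; apply: itU_mono (H _) => [f _|j]; first by rewrite sat_AndI.
  by apply: HE; rewrite leq_max (leq_bigmax j) orbT.
(* This fixes J. The outermost remaining quantifier is that of b, so the set [Sb] of suitable b
   belongs to [U] and is not good. *)
move=> /(itU_pick UU UXa (fun=> Xy0))[g Xg /=].
rewrite (ultra_ext UU (fun y => itU_upd UU _ _ _ (leqnn N))).
set Sb : set Y := (X in U X) => USb.
pose rhoE (z : S * 'I_m) : 'I_m + (X + (nat + nat) * 'I_m) :=
  (* With I + J as the parameters d, the formula [theta(x, d)] below says that [Phi(x, w)] holds for
     every w that can replace b in [E]. *)
  if retr z.1 is Some t then inr (inr (t, z.2)) else inl z.2.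
pose theta := AllI (Imp (rename rhoE E) (rename (scat (inr \o inl) inl) Phi)).
have theta_sat x d : sat (scat x d) theta <-> forall w,
    sat (scat w (scat x d) \o rhoE) E -> sat (scat x w) Phi.
  rewrite sat_AllI; split=> H w; move: (H w);
  by rewrite /= !sat_rename scat_comp.
have asg_rho f w x : scat w (scat x (asgD f N)) \o rhoE = asg (upd f N w) N.
  apply: funext => -[t0 q]; rewrite /rhoE /asg /=.
  case Es: (retr t0) => [t|] /=.
    by rewrite (retrK Es) upd_neq // pos_emb.
  by rewrite (retr_None Es) /= updE.
have [l [alpha [Salpha nd]]] : exists l (alpha : 'I_l -> Y),
    (forall j, Sb (alpha j)) /\ ~ exists d : (nat + nat) * 'I_m -> M,
      [/\ forall z, A (d z), sat (scat a d) theta &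
      forall j x, sat (scat x d) theta -> sat (scat x (alpha j)) Phi].
  apply: contrapT => nG; apply: (U_not_good USb).
  exists ((nat + nat) * 'I_m)%type, theta => l alpha Ha.
  by apply: contrapT => nd; apply: nG; exists l, alpha.
(* The family [alpha] may be empty, so [b0] is used to secure [D], which does not depend on b. *)
have [b0 Sb0] := ultra_ex UU USb.
have /(itU_witness UU UXa Xg)[f [Xf _ [[Db0 _] Eal]]] :=
  itU_and UU Sb0 (itU_forall UU Salpha).
have AsgD f' w : asgD (upd f' N w) N = asgD f' N.
  by apply: funext => z; rewrite /asgD upd_neq // pos_emb.
(* Each [alpha j] can replace b in [E], so [theta(x, d)] implies [Phi(x, alpha j)]. By the choice of
   [alpha], [theta(a, d)] must then fail, which yields [w]. *)
have [w Ew nw] : exists2 w, sat (asg (upd f N w) N) E & ~ sat (scat a w) Phi.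
  apply: contrapT => nw; apply: nd; exists (asgD f N); split.
  - by move=> z; have [Af _] := Xf (pos N (emb z.1)); exact: Af.
  - apply/theta_sat => w; rewrite asg_rho => Ew.
    by apply: contrapT => nPhi; apply: nw; exists w.
  - move=> j x /theta_sat; apply; rewrite asg_rho.
    by case: (Eal j).
exists (scat a (asg (upd f N w) N)) => j.
have [_ _] := Hp j; apply; first exact: nw.
- by apply: funext => q; rewrite /asg /= updE.
- have := Db0 j; rewrite AsgD.
  have -> // : asg (upd f N w) N \o embD = asgD f N.
  exact: AsgD.
- by move: Ew; rewrite sat_AndI.
Qed.

Definition sum_ltS : S -> S -> Prop :=
  sum_lt (sum_lt (fun i j : nat => (i < j)%O : Prop) (fun _ _ : unit => False))
    (fun i j : nat => (i < j)%O : Prop).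

Lemma pos_increasing k (i : 'I_k -> S) : increasing sum_ltS i ->
  exists n, forall N, (n <= N)%N ->
    (forall p q : 'I_k, (p < q)%N -> (pos N (i p) < pos N (i q))%N) /\
    (forall p, pos N (i p) < N + N.+1)%N.
Proof.
move=> inc.
pose h (s : S) : nat := match s with inl (inl i) => i | inr j => j | _ => 0 end.
exists (\max_p h (i p)).+1 => N ltN.
have hN p : (h (i p) < N)%N by apply: leq_trans ltN; rewrite ltnS (leq_bigmax p).
split=> [p q pq|p].
  move: (inc p q pq) (hN p) (hN q); rewrite /sum_ltS.
  case: (i p) (i q) => [[x|[]]|x] [[y|[]]|y] //= lt hp hq; rewrite ?hp ?hq //.
  - by rewrite addSn ltnS (leq_trans (ltnW hp)) ?leq_addr.
  - by rewrite addSn ltnS leq_addr.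
  - by rewrite ltn_add2l.
move: (hN p); case: (i p) => [[x|[]]|x] //= hp.
- by rewrite hp addnS ltnS (leq_trans (ltnW hp)) ?leq_addr.
- by rewrite addnS ltnS leq_addr.
- by rewrite addSn addnS ltnS ltn_add2l.
Qed.

(** The second side does not mention [i]: any two increasing tuples eventually have the same
    properties, whence indiscernibility. *)
Lemma ev_subseq k (i : 'I_k -> S) (P : ('I_k -> Y) -> Prop) :
  increasing sum_ltS i ->
  exists n, forall N, (n <= N)%N ->
    itU U g0 (N + N.+1) (fun f => P (fun p => f (pos N (i p)))) <->
    itU U g0 k (fun f => P (fun p => f p)).
Proof.
move=> /pos_increasing[n Hn]; exists n => N /Hn[inc bnd].
pose j q := if insub q is Some p then pos N (i p) else 0.
have jE (p : 'I_k) : j p = pos N (i p).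
  by rewrite /j; case: insubP => [p' _ /val_inj -> //|]; rewrite ltn_ord.
rewrite -(@itU_subseq _ _ UU g0 g0 (N + N.+1) k j).
- apply: itU_ext => // f _.
  suff -> : (fun p : 'I_k => if (p < k)%N then f (j p) else g0 p) =
    (fun p => f (pos N (i p))) by [].
  by apply: funext => p; rewrite ltn_ord jE.
- move=> p q /andP[pq qk].
  by have := inc (Ordinal (ltn_trans pq qk)) (Ordinal qk) pq; rewrite -!jE.
- by move=> p pk; have := bnd (Ordinal pk); rewrite -jE.
Qed.

Lemma ev_indiscernible k (i j : 'I_k -> S) (P : ('I_k -> Y) -> Prop) :
  increasing sum_ltS i -> increasing sum_ltS j ->
  ev (fun N f => P (fun p => f (pos N (i p))) -> P (fun p => f (pos N (j p)))).
Proof.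
move=> /(ev_subseq P)[n Hn] /(ev_subseq P)[n' Hn'].
exists (maxn n n') => N; rewrite geq_max => /andP[/Hn + /Hn'].
by rewrite itU_imp // => -> ->.
Qed.

(** In a realization of [EM_type], I + b + J is indiscernible and I + J is indiscernible over [a].
    Distality makes I + b + J indiscernible over [a], yet [Phi(a, .)] separates I from b. *)
Lemma not_all_bad : False.
Proof.
have [N [v [NM HG]]] := compactness EM_type_fin_sat.
have N_T : models N T by move=> s /M_T /NM.
pose aN := v \o inl.
pose c (s : S) (q : 'I_m) := v (inr (s, q)).
have HD delta : ev (fun N f => sat (scat a (asgD f N)) delta) ->
    sat (scat aN (fun z => c (emb z.1) z.2)) delta.
  by move=> /EM_D /HG; rewrite sat_rename scat_comp.
have HE eps : ev (fun N f => sat (asg f N) eps) ->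
    sat (fun z => c z.1 z.2) eps.
  move=> /EM_E /HG; rewrite sat_rename.
  by apply: iffLR; apply: sat_ext => -[].
have nb : ~ sat (scat aN (c mid)) Phi.
  by have := HG _ EM_b; rewrite sat_Neg sat_rename scat_comp.
(* The entries of the Morley sequence may be taken in [Xa], which belongs to [U]. *)
have c0 : sat (scat aN (c (emb (inl 0)))) Phi.
  have := HD (rename (scat inl (fun q => inr (inl 0, q))) Phi).
  rewrite sat_rename scat_comp; apply.
  exists 0 => n _; apply: (@itU_true_in _ _ UU Xa) => // f Xf.
  rewrite sat_rename scat_comp; case: (Xf (pos n (emb (inl 0)))) => _.
  exact.
pose B := range aN.
have /choice[rB HrB] : forall b : set_type B, exists x, aN x = set_val b.
  by move=> b; have [x _ xb] := set_valP b; exists x.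
have ind0 : indiscernible sum_ltS c set0.
  move=> k phi i j inci incj.
  suff H i' j' : increasing sum_ltS i' -> increasing sum_ltS j' ->
      sat (scat (fun pq => c (i' pq.1) pq.2) (@set_val N set0)) phi ->
      sat (scat (fun pq => c (j' pq.1) pq.2) (@set_val N set0)) phi.
    by split; exact: H.
  move=> inci' incj'.
  (* There are no parameters here, so the values given below to parameter variables are vacuous. *)
  have noB : set_type (@set0 N) -> False by move=> x; exact: (set_valP x).
  pose r (i : 'I_k -> S) (z : 'I_k * 'I_m + set_type (@set0 N)) : S * 'I_m :=
    match z with inl pq => (i pq.1, pq.2) | inr x => match noB x with end end.
  have := HE (Imp (rename (r i') phi) (rename (r j') phi)).
  have E (W : Type) (i0 : 'I_k -> S) (u : S * 'I_m -> W) (u' : set_type (@set0 N) -> W) :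
      u \o r i0 = scat (fun pq => u (i0 pq.1, pq.2)) u'.
    by apply: funext => -[//|x]; case: (noB x).
  rewrite /= !sat_rename.
  rewrite !(E _ _ _ (@set_val N set0)); apply.
  pose P (h : 'I_k -> Y) := sat (scat (fun pq => h pq.1 pq.2)
    (fun x : set_type (@set0 N) => y0 match noB x with end)) phi.
  have [n Hn] := ev_indiscernible P inci' incj'.
  exists n => N' /Hn; apply: itU_mono => // f _.
  by rewrite /= !sat_rename !(E _ _ _ (fun x => y0 match noB x with end)).
pose ltIJ := sum_lt (fun i j : nat => (i < j)%O : Prop)
  (fun i j : nat => (i < j)%O : Prop).
have indB : indiscernible ltIJ (c \o emb) B.
  move=> k phi i j inci incj.
  suff H i' j' : increasing ltIJ i' -> increasing ltIJ j' ->
      sat (scat (fun pq => (c \o emb) (i' pq.1) pq.2) (@set_val N B)) phi ->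
      sat (scat (fun pq => (c \o emb) (j' pq.1) pq.2) (@set_val N B)) phi.
    by split; exact: H.
  move=> inci' incj'.
  pose r (i : 'I_k -> nat + nat) : 'I_k * 'I_m + set_type B -> X + (nat + nat) * 'I_m :=
    scat (fun pq => inr (i pq.1, pq.2)) (inl \o rB).
  have := HD (Imp (rename (r i') phi) (rename (r j') phi)).
  have vB : aN \o rB = @set_val N B by apply: funext => x; exact: HrB.
  rewrite /= !sat_rename !scat_comp -vB; apply.
  pose P (h : 'I_k -> Y) := sat (scat (fun pq => h pq.1 pq.2) (a \o rB)) phi.
  have emb_inc i0 : increasing ltIJ i0 -> increasing sum_ltS (emb \o i0).
    move=> inc p q /inc /=; by case: (i0 p) (i0 q) => [x|x] [y|y].
  have [n Hn] := ev_indiscernible P (emb_inc _ _ inci') (emb_inc _ _ incj').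
  exists n => N' /Hn; apply: itU_mono => // f _.
  by rewrite /= !sat_rename !scat_comp.
have [_ /(_ N N_T _ _ nat nat m (c \o inl \o inl) (c mid) (c \o inr) B)] := T_distal.
have cE : scat (scat (c \o inl \o inl) (fun=> c mid)) (c \o inr) = c.
  by apply: funext => -[[i|[]]|j].
have cE' : scat (c \o inl \o inl) (c \o inr) = c \o emb.
  by apply: funext => -[i|j].
rewrite /= cE cE' => /(_ infinite_nat infinite_nat ind0 indB).
have inBP x : B (aN x) by exists x.
pose inB x : set_type B := exist _ (aN x) (mem_set (inBP x)).
(* Indiscernibility is applied to sequences of length one: the first entry of I against b. *)
move=> /(_ 1 (rename (scat (inr \o inB) (fun q => inl (ord0, q))) Phi)
  (fun=> emb (inl 0)) (fun=> mid)) [].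
- by move=> p q; rewrite !ord1.
- by move=> p q; rewrite !ord1.
by rewrite sat_rename scat_comp => /(_ c0); rewrite sat_rename scat_comp.
Qed.

End Ultra.

Lemma good_distal : good A Phi a Xa.
Proof.
apply: contrapT => /not_good_ultra[U UU [UXa Ubad]].
have [y0 Xy0] := ultra_ex UU UXa.
exact: (not_all_bad UU UXa Ubad Xy0).
Qed.

End DistalGood.

(** * The hypotheses on A, for variables indexed by finite types *)

Lemma card_le_II_enum (T : Type) (F : set T) k c0 : F c0 -> (F #<= `I_k)%card ->
  exists e : 'I_k -> T, (forall j, F (e j)) /\ forall c, F c -> exists j, e j = c.
Proof.
move=> Fc0 /pcard_leP /injfunPex[f fk finj].
(* [e] inverts the injection [f] on its image and takes values in [F] elsewhere. *)
have /choice[e He] : forall j : 'I_k, exists c, F c /\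
    ((exists2 c', F c' & f c' = j) -> f c = j).
  move=> j; have [[c Fc fc]|n] := pselect (exists2 c', F c' & f c' = j).
    by exists c.
  by exists c0; split=> // /n.
exists e; split=> [j|c Fc]; first by case: (He j).
exists (Ordinal (fk c Fc)); case: (He (Ordinal (fk c Fc))) => Fe E.
by apply: finj; rewrite ?inE //; apply: E; exists c.
Qed.

Lemma finite_enum (T : Type) (F : set T) : finite_set F ->
  exists k (e : 'I_k -> T),
    (forall j, F (e j)) /\ forall c, F c -> exists j, e j = c.
Proof.
move=> /finite_setP[k]; rewrite card_eq_le => /andP[Fk _].
have [[c0 Fc0]|nF] := pselect (exists c, F c).
  by exists k; exact: card_le_II_enum Fc0 Fk.
exists 0, (fun i : 'I_0 => match notF (ltn_ord i) with end).
by split=> [[]//|c Fc]; case: nF; exists c.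
Qed.

Section Hypotheses.
Variables (L : language) (M : structure L) (A : set M).

Lemma use_fin (A_use : uniformly_stably_embedded A) (Z Y : finType)
    (phi : formula L (Z + Y)) :
  exists q (psi : formula L (Z + 'I_q)), forall c : Y -> M,
  exists2 b : 'I_q -> M, (forall i, A (b i)) &
    forall a, (forall z, A (a z)) ->
      (sat (scat a c) phi <-> sat (scat a b) psi).
Proof.
have [q [psi H]] := A_use _ _
  (rename (scat (inl \o @enum_rank Z) (inr \o @enum_rank Y)) phi).
exists q, (rename (scat (inl \o enum_val) inr) psi) => c.
have [b Ab Hb] := H (c \o enum_val).
exists b => [i|a Aa]; first by apply: Ab; exists i.
have -> : sat (scat a c) phi <-> sat (scat (a \o enum_val) (c \o enum_val))
    (rename (scat (inl \o @enum_rank Z) (inr \o @enum_rank Y)) phi).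
  by rewrite sat_rename; apply: sat_ext => -[z|y] /=; rewrite enum_rankK.
rewrite Hb; last by move=> _ [i _ <-]; exact: Aa.
by rewrite sat_rename scat_comp.
Qed.

(** The formulas [Phi(v, x, alpha)], for [alpha] in [A], form a type in the single variable x over
    [A] and the range of [v]. *)
Lemma small_fin (A_small : small A) (V Z : finType)
    (Phi : formula L (option V + Z)) (v : V -> M) :
  (forall k (alpha : 'I_k -> Z -> M), (forall j z, A (alpha j z)) ->
     exists x, forall j, sat (scat (oapp v x) (alpha j)) Phi) ->
  exists x, forall alpha, (forall z, A (alpha z)) ->
    sat (scat (oapp v x) alpha) Phi.
Proof.
move=> fin_sat; pose b := v \o @enum_val V predT.
pose C := A `|` range b.
have Cv u : C (v u) by right; exists (enum_rank u); rewrite // /b /= enum_rankK.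
have CA (x : set_type A) : C (set_val x) by left; exact: set_valP.
pose rho (alpha : Z -> set_type A) (t : option V + Z) : 'I_1 + set_type C :=
  match t with
  | inl None => inl ord0
  | inl (Some u) => inr (exist _ (v u) (mem_set (Cv u)))
  | inr z => inr (exist _ (set_val (alpha z)) (mem_set (CA (alpha z))))
  end.
have rhoE alpha (a : 'I_1 -> M) : scat a (@set_val M C) \o rho alpha =
    scat (oapp v (a ord0)) (@set_val M A \o alpha).
  by apply: funext => -[[u|]|z].
have [|a Ha] := A_small _ b 1 [set g | exists alpha, g = rename (rho alpha) Phi].
  move=> F Fp /finite_enum[k [e [Fe eF]]].
  have /choice[alpha Halpha] : forall j, exists alpha, e j = rename (rho alpha) Phi.
    by move=> j; exact: Fp.
  have [j z|x Hx] := fin_sat k (fun j => @set_val M A \o alpha j).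
    exact: set_valP.
  exists (fun=> x) => g /eF[j <-].
  by rewrite /= Halpha; apply/sat_rename; rewrite rhoE.
exists (a ord0) => alpha Aalpha.
pose beta z : set_type A := exist _ (alpha z) (mem_set (Aalpha z)).
have : sat (scat a (@set_val M C)) (rename (rho beta) Phi).
  by apply: Ha; exists beta.
by rewrite sat_rename rhoE.
Qed.

(** In the induced structure [xi] is an atomic relation. *)
Lemma ind_formula n m (xi : formula L ('I_n + 'I_m)) :
  exists phi : formula (ind_language L) ('I_n + 'I_m),
  forall v : 'I_n + 'I_m -> ind_structure A,
    sat v phi <-> sat (@set_val M A \o v) xi.
Proof.
exists (@Rel (ind_language L) _
  (existT (fun n => formula L 'I_n) (n + m)%N (rename (@unsplit n m) xi))
  (fun i => Var (fintype.split i))) => v /=.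
rewrite sat_rename; apply: sat_ext => t /=.
by rewrite unsplitK.
Qed.

(** The hypothesis is applied to the induced structure as an elementary extension of itself. The
    fixed parameters [z] become part of the instances, and [psi] forces that part to equal [z]. *)
Lemma nfcp_fin (A_dnfcp : dnfcp' (Th (ind_structure A))) (a0 : M) (Aa0 : A a0)
    (X Y Z : finType) (xi : formula L (X + (Y + Z))) :
  exists k, forall z : Z -> M, (forall i, A (z i)) ->
    let cons k := forall alpha : 'I_k -> Y -> M, (forall j y, A (alpha j y)) ->
      exists2 d : X -> M, forall x, A (d x) &
        forall j, sat (scat d (scat (alpha j) z)) xi in
    cons k -> forall K, cons K.
Proof.
pose N := ind_structure A.
pose toA (W : Type) (u : W -> M) (Au : forall w, A (u w)) : W -> N :=
  fun w => exist _ (u w) (mem_set (Au w)).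
have toAE W u Au w : set_val (toA W u Au w) = u w by [].
pose xi' := rename (scat (inl \o @enum_rank X) (inr \o @enum_rank (Y + Z)%type)) xi.
have [phi Hphi] := ind_formula xi'.
pose psi : formula (ind_language L) ('I_#|{: Y + Z}| + 'I_#|Z|) :=
  AndI (fun i => Eql (Var (inl (enum_rank (inr (enum_val i))))) (Var (inr i))).
have el : elementary (@id N) by move=> n f v.
have [k Hk] := A_dnfcp N N id (fun s => id) (fun s => id) el _ _ _ phi psi.
exists k => z Az cons consk K.
pose b : 'I_#|Z| -> N := toA _ (z \o enum_val) (fun i => Az (enum_val i)).
have {Hk} := Hk b.
set C := [set c | _]; move=> /= Hk.
have CP c : C c <-> forall i, set_val (c (enum_rank (inr i))) = z i.
  split=> [[_ /sat_AndI H] i|H].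
    have := congr1 (@set_val M A) (H (enum_rank i)).
    by rewrite /= enum_rankK toAE /= enum_rankK.
  split; first by move=> y _; exists y.
  apply/sat_AndI => i /=; apply: val_inj => /=.
  exact: H.
have phiE (d : 'I_#|X| -> N) c : C c -> sat (scat d c) phi <->
    sat (scat (fun x => set_val (d (enum_rank x)))
      (scat (fun y => set_val (c (enum_rank (inl y)))) z)) xi.
  move=> /CP Hc; rewrite Hphi sat_rename; apply: sat_ext.
  by move=> [x|[y|i]] //=.
have /Hk {}Hk : k_consistent k phi C.
  move=> F FC Fk.
  (* Even an empty set of instances requires a tuple of [A], built from [a0]. *)
  have [[c0 Fc0]|nF] := pselect (exists c, F c); last first.
    exists (toA _ (fun=> a0) (fun=> Aa0)) => c Fc.
    by case: nF; exists c.
  have [e [Fe eF]] := card_le_II_enum Fc0 Fk.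
  have [|d Ad Hd] := consk (fun j y => set_val (e j (enum_rank (inl y)))).
    by move=> j y; exact: set_valP.
  exists (toA _ (d \o enum_val) (fun i => Ad (enum_val i))) => c Fc.
  apply/phiE; first exact: FC.
  have [j ec] := eF _ Fc.
  apply: iffLR (Hd j); apply: sat_ext => -[x|[y|i]] //=; last by rewrite ec.
  by rewrite toAE /= enum_rankK.
move=> alpha Aalpha.
pose c j : 'I_#|{: Y + Z}| -> N :=
  toA _ (scat (alpha j) z \o enum_val)
    (fun i => match enum_val i as t return A (scat (alpha j) z t) with
              | inl y => Aalpha j y | inr i' => Az i' end).
have Cc j : C (c j) by apply/CP => i; rewrite toAE /= enum_rankK.
have [||d Hd] := Hk (range c).
- by move=> _ [j _ <-].
- by apply: finite_image; exact: finite_finset.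
exists (fun x => set_val (d (enum_rank x))) => [x|j]; first exact: set_valP.
have /phiE - /(_ (Cc j)) := Hd (c j) (ex_intro2 _ _ j I erefl).
apply: iffLR; apply: sat_ext => -[x|[y|i]] //=.
by rewrite toAE /= enum_rankK.
Qed.

End Hypotheses.

(** * Bounded formulas *)

Section Bounded.
Variables (L : language) (M : structure L) (A : set M).
Let PM := pair_structure A.

Lemma eval_lift (V : Type) (v : V -> M) (t : term L V) :
  eval (M := PM) v (term_lift t) = eval v t.
Proof.
by elim: t => //= f ts IH; congr finterp; apply: funext.
Qed.

Lemma sat_lift (V : Type) (v : V -> M) (phi : formula L V) :
  sat (M := PM) v (formula_lift phi) <-> sat v phi.
Proof.
elim: phi v => {V} //=.
- by move=> V s t v; rewrite !eval_lift.
- move=> V r ts v.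
  suff -> : (fun i => eval (M := PM) v (term_lift (ts i))) =
            (fun i => eval v (ts i)) by [].
  by apply: funext => i; rewrite eval_lift.
- by move=> V p IHp q IHq v; rewrite IHp IHq.
- by move=> V p IH v; split=> H x; apply/IH; exact: H.
Qed.

(** Boundedness is studied for sets definable in the single structure (M, A); [P_bounded_of_bounded]
    transfers the result to its theory. *)
Definition bounded (V : Type) (D : (V -> M) -> Prop) :=
  exists2 psi : formula (pair_language L) V,
    P_bounded_formula psi & forall v, D v <-> sat (M := PM) v psi.

Lemma bounded_ext (V : Type) (D D' : (V -> M) -> Prop) :
  (forall v, D' v <-> D v) -> bounded D -> bounded D'.
Proof. by move=> DD' [psi Bpsi H]; exists psi => // v; rewrite DD'. Qed.

Lemma bounded_sat (V : Type) (phi : formula L V) : bounded (fun v => sat v phi).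
Proof.
by exists (formula_lift phi) => [|v]; [constructor | rewrite sat_lift].
Qed.

Lemma bounded_ex1 (V : Type) (D : (option V -> M) -> Prop) :
  bounded D -> bounded (fun v => exists2 x, A x & D (oapp v x)).
Proof.
move=> [psi Bpsi H]; exists (Ex (And (in_P (Var None)) psi)) => [|v].
  by constructor.
rewrite sat_Ex; split=> -[x].
  by move=> Ax /H Hx; exists x; rewrite sat_And.
by rewrite sat_And => -[Ax Hx]; exists x => //; apply/H.
Qed.

Lemma bounded_all1 (V : Type) (D : (option V -> M) -> Prop) :
  bounded D -> bounded (fun v => forall x, A x -> D (oapp v x)).
Proof.
move=> [psi Bpsi H]; exists (All (Imp (in_P (Var None)) psi)) => [|v].
  by constructor.
by split=> /= Hx x Ax; apply/H; exact: Hx.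
Qed.

Lemma bounded_rename (V W : Type) (f : V -> W) (D : (V -> M) -> Prop) :
  bounded D -> bounded (fun w => D (w \o f)).
Proof.
move=> [psi Bpsi H].
apply: (@bounded_ext _ (fun w => sat (M := PM) (w \o f) psi)).
  by move=> w; exact: H.
move: W f; elim: {D H} Bpsi => {V psi} V phi.
- move=> W f; apply: bounded_ext (bounded_sat (rename f phi)) => w.
  by rewrite sat_rename sat_lift.
- move=> _ IH W f; apply: bounded_ext (bounded_ex1 (IH _ (omap f))) => w.
  rewrite sat_Ex; split=> -[x].
    rewrite sat_And => -[Ax Hx]; exists x => //.
    by apply: iffLR Hx; apply: sat_ext; case.
  move=> Ax Hx; exists x; rewrite sat_And; split=> //.
  by apply: iffLR Hx; apply: sat_ext; case.
- move=> _ IH W f; apply: bounded_ext (bounded_all1 (IH _ (omap f))) => w /=.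
  by split=> Hx x Ax; move: (Hx x Ax); apply: iffLR; apply: sat_ext; case.
Qed.

Lemma bounded_all_ord k (V : Type) (D : ('I_k + V -> M) -> Prop) :
  bounded D -> bounded (fun v => forall w, (forall i, A (w i)) -> D (scat w v)).
Proof.
elim: k V D => [|k IH] V D BD.
  pose f : 'I_0 + V -> V :=
    scat (fun i : 'I_0 => match notF (ltn_ord i) with end) id.
  apply: bounded_ext (bounded_rename f BD) => v.
  have E w : scat w v = v \o f by apply: funext => -[[]|].
  split=> [H|H w _]; last by rewrite E.
  by rewrite -(E (v \o f \o inl)); apply: H => -[].
apply: bounded_ext (bounded_all1 (IH _ _ (bounded_rename (@shift_block V k) BD))) => v.
split=> [H x Ax w Aw|H w Aw].
  rewrite scat_shift_block; apply: H => i; rewrite /ocons.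
  by case: unlift => //= j; exact: Aw.
by rewrite (oconsE w) -scat_shift_block; apply: H => // i; exact: Aw.
Qed.

Lemma bounded_ex_ord k (V : Type) (D : ('I_k + V -> M) -> Prop) :
  bounded D -> bounded (fun v => exists2 w, forall i, A (w i) & D (scat w v)).
Proof.
elim: k V D => [|k IH] V D BD.
  pose f : 'I_0 + V -> V :=
    scat (fun i : 'I_0 => match notF (ltn_ord i) with end) id.
  apply: bounded_ext (bounded_rename f BD) => v.
  have E w : scat w v = v \o f by apply: funext => -[[]|].
  split=> [[w _]|H]; first by rewrite E.
  by exists (v \o f \o inl); [case | rewrite E].
apply: bounded_ext (bounded_ex1 (IH _ _ (bounded_rename (@shift_block V k) BD))) => v.
split=> [[w Aw]|[x Ax [w Aw]]].
  rewrite (oconsE w) -scat_shift_block => H.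
  by exists (w ord0) => //; exists (fun i => w (lift ord0 i)).
rewrite scat_shift_block => H; exists (ocons x w) => // i; rewrite /ocons.
by case: unlift => //= j; exact: Aw.
Qed.

Lemma bounded_all (Z : finType) (V : Type) (D : (Z + V -> M) -> Prop) :
  bounded D -> bounded (fun v => forall w, (forall i, A (w i)) -> D (scat w v)).
Proof.
move=> /(bounded_rename (scat (inl \o @enum_rank Z) (@inr 'I_#|Z| V))).
move=> /bounded_all_ord; apply: bounded_ext => v.
split=> H w Aw; first by rewrite scat_comp; apply: H => i; exact: Aw.
have /= := H (w \o enum_val) (fun i => Aw _); rewrite scat_comp.
suff -> : scat (w \o enum_val) v \o (inl \o @enum_rank Z) = w by [].
by apply: funext => z /=; rewrite enum_rankK.
Qed.

Lemma bounded_ex (Z : finType) (V : Type) (D : (Z + V -> M) -> Prop) :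
  bounded D -> bounded (fun v => exists2 w, forall i, A (w i) & D (scat w v)).
Proof.
move=> /(bounded_rename (scat (inl \o @enum_rank Z) (@inr 'I_#|Z| V))).
move=> /bounded_ex_ord; apply: bounded_ext => v.
split=> -[w Aw Hw].
  exists (w \o enum_val) => [i|]; first exact: Aw.
  rewrite scat_comp.
  suff -> : scat (w \o enum_val) v \o (inl \o @enum_rank Z) = w by [].
  by apply: funext => z /=; rewrite enum_rankK.
by exists (w \o enum_rank) => [i|]; [exact: Aw | rewrite scat_comp in Hw].
Qed.

(* [Q] is the quantifier prefix, as an operator on subsets of [A]^[Z]. *)
Lemma bounded_prenex (V : Type) (D : (V -> M) -> Prop) : bounded D ->
  exists (Z : finType) (phi : formula L (Z + V)) (Q : ((Z -> M) -> Prop) -> Prop),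
  [/\ forall v, D v <-> Q (fun alpha => sat (scat alpha v) phi),
      forall P P', (forall alpha, (forall z, A (alpha z)) -> (P alpha <-> P' alpha)) ->
        (Q P <-> Q P') &
      forall (W : Type) (E : (Z + W -> M) -> Prop), bounded E ->
        bounded (fun w => Q (fun alpha => E (scat alpha w)))].
Proof.
pose rho (Z : finType) (W : Type) (t : Z + option W) : option Z + W :=
  match t with
  | inl z => inl (Some z) | inr None => inl None | inr (Some w) => inr w
  end.
pose rho' (Z : finType) (W : Type) (t : option Z + W) : Z + option W :=
  match t with
  | inl (Some z) => inl z | inl None => inr None | inr w => inr (Some w)
  end.
have rhoE (Z : finType) W (alpha : Z -> M) (x : M) (w : W -> M) :
    scat (oapp alpha x) w \o @rho Z W = scat alpha (oapp w x).
  by apply: funext => -[z|[u|]].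
have rhoE' (Z : finType) W (alpha : Z -> M) (x : M) (w : W -> M) :
    scat alpha (oapp w x) \o @rho' Z W = scat (oapp alpha x) w.
  by apply: funext => -[[z|]|u].
have oA (Z : finType) (alpha : Z -> M) x : (forall z, A (alpha z)) -> A x ->
  forall z, A (oapp alpha x z) by move=> ? ? [].
case=> psi Bpsi HD.
suff [Z [phi [Q [H1 H2 H3]]]] : exists (Z : finType) (phi : formula L (Z + V))
    (Q : ((Z -> M) -> Prop) -> Prop),
  [/\ forall v, sat (M := PM) v psi <-> Q (fun alpha => sat (scat alpha v) phi),
      forall P P', (forall alpha, (forall z, A (alpha z)) -> (P alpha <-> P' alpha)) ->
        (Q P <-> Q P') &
      forall (W : Type) (E : (Z + W -> M) -> Prop), bounded E ->
        bounded (fun w => Q (fun alpha => E (scat alpha w)))].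
  by exists Z, phi, Q; split=> // v; rewrite HD.
elim: {D HD} Bpsi => {V psi} V psi' => [|_|_].
- exists void, (rename inr psi'), (fun P => P (of_void M)); split.
  + by move=> v; rewrite sat_rename sat_lift.
  + by move=> P P'; apply; case.
  + move=> W E /(bounded_rename (scat (of_void W) id)); apply: bounded_ext => w.
    suff -> : w \o scat (of_void W) id = scat (of_void M) w by [].
    by apply: funext => -[[]|].
- move=> [Z [phi [Q [H1 H2 H3]]]].
  exists (option Z), (rename (@rho Z V) phi),
    (fun P => exists2 x, A x & Q (fun alpha => P (oapp alpha x))); split.
  + move=> v; rewrite sat_Ex.
    have E x : Q (fun alpha => sat (scat (oapp alpha x) v) (rename (@rho Z V) phi)) <->
        sat (M := PM) (oapp v x) psi'.
      by rewrite H1; apply: H2 => alpha _; rewrite sat_rename rhoE.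
    split=> -[x]; first by rewrite sat_And => -[Ax /E]; exists x.
    by move=> Ax /E; exists x; rewrite sat_And.
  + move=> P P' PP'; split=> -[x Ax Hx]; exists x => //; move: Hx; apply: iffLR;
    by apply: H2 => alpha Aalpha; rewrite PP' //; exact: oA.
  + move=> W E /(bounded_rename (@rho' Z W)) /H3 /bounded_ex1.
    apply: bounded_ext => w; split=> -[x Ax Hx]; exists x => //; move: Hx;
    by apply: iffLR; apply: H2 => alpha _; rewrite /= rhoE'.
- move=> [Z [phi [Q [H1 H2 H3]]]].
  exists (option Z), (rename (@rho Z V) phi),
    (fun P => forall x, A x -> Q (fun alpha => P (oapp alpha x))); split.
  + move=> v /=.
    have E x : Q (fun alpha => sat (scat (oapp alpha x) v) (rename (@rho Z V) phi)) <->
        sat (M := PM) (oapp v x) psi'.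
      by rewrite H1; apply: H2 => alpha _; rewrite sat_rename rhoE.
    by split=> H x Ax; apply/E; exact: H.
  + move=> P P' PP'; split=> H x Ax; move: (H x Ax); apply: iffLR;
    by apply: H2 => alpha Aalpha; rewrite PP' //; exact: oA.
  + move=> W E /(bounded_rename (@rho' Z W)) /H3 /bounded_all1.
    apply: bounded_ext => w; split=> H x Ax; move: (H x Ax);
    by apply: iffLR; apply: H2 => alpha _; rewrite /= rhoE'.
Qed.

Section Nonempty.
Variables (a0 : M) (Aa0 : A a0).

(* Pulling a bounded quantifier out of an implication needs A to be nonempty. *)
Lemma bounded_imp (V : Type) (D D' : (V -> M) -> Prop) :
  bounded D -> bounded D' -> bounded (fun v => D v -> D' v).
Proof.
move=> [psi Bpsi H] BD'.
apply: (@bounded_ext _ (fun v => sat (M := PM) v psi -> D' v)).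
  by move=> v; rewrite H.
move: D' BD'; elim: {D H} Bpsi => {V psi} V phi.
- move=> D' [psi' Bpsi' H'].
  apply: (@bounded_ext _ (fun v => sat v phi -> sat (M := PM) v psi')).
    by move=> v; rewrite H' sat_lift.
  move: phi; elim: {D' H'} Bpsi' => {V psi'} V psi' => [|_ IH|_ IH] phi.
  + by apply: bounded_ext (bounded_sat (Imp phi psi')) => v; rewrite sat_lift.
  + apply: bounded_ext (bounded_ex1 (IH (rename Some phi))) => v.
    rewrite sat_Ex; split=> [H|[x Ax H] Hphi]; last first.
      by exists x; rewrite sat_And; split=> //; apply: H; rewrite sat_rename.
    have [/H[x]|nphi] := pselect (sat v phi).
      by rewrite sat_And => -[Ax Hx]; exists x.
    (* If the premise fails, any element of [A] is a witness. *)
    by exists a0 => //; rewrite sat_rename => /nphi.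
  + apply: bounded_ext (bounded_all1 (IH (rename Some phi))) => v /=.
    split=> H; first by move=> x Ax; rewrite sat_rename => Hphi; exact: H.
    by move=> Hphi x Ax; apply: H => //; rewrite sat_rename.
- move=> _ IH D' BD'.
  apply: bounded_ext (bounded_all1 (IH _ (bounded_rename Some BD'))) => v.
  rewrite sat_Ex; split=> H.
    by move=> x Ax Hx; apply: H; exists x; rewrite sat_And.
  by move=> [x]; rewrite sat_And => -[Ax Hx]; exact: (H x Ax Hx).
- move=> _ IH D' BD'.
  apply: bounded_ext (bounded_ex1 (IH _ (bounded_rename Some BD'))) => v /=.
  split=> [H|[x Ax H] Hx]; last by apply: H; exact: Hx.
  have [/H HD'|] := pselect (forall x, A x -> sat (M := PM) (oapp v x) phi).
    by exists a0.
  by move=> /existsNP[x] /not_implyP[Ax nx]; exists x.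
Qed.

Lemma bounded_not (V : Type) (D : (V -> M) -> Prop) :
  bounded D -> bounded (fun v => ~ D v).
Proof. by move=> BD; apply: bounded_imp BD (bounded_sat Bot). Qed.

Lemma bounded_and (V : Type) (D D' : (V -> M) -> Prop) :
  bounded D -> bounded D' -> bounded (fun v => D v /\ D' v).
Proof.
move=> BD BD'; apply: bounded_ext (bounded_not (bounded_imp BD (bounded_not BD'))).
move=> v; split=> [[HD HD'] H|H]; first exact: H.
by split; apply: contrapT => nH; apply: H => // ? ?.
Qed.

Lemma bounded_exists k (V : Type) (D : 'I_k -> (V -> M) -> Prop) :
  (forall i, bounded (D i)) -> bounded (fun v => exists i, D i v).
Proof.
elim: k D => [|k IH] D BD.
  by apply: bounded_ext (bounded_sat Bot) => v; split=> // -[[]].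
apply: bounded_ext (bounded_imp (bounded_not (BD ord0))
  (IH _ (fun i => BD (lift ord0 i)))) => v.
split=> [[i Di] nD|H].
  by case: (unliftP ord0 i) Di => [j|] -> // Dj; exists j.
have [D0|/H[j Dj]] := pselect (D ord0 v); first by exists ord0.
by exists (lift ord0 j).
Qed.

End Nonempty.
End Bounded.

(** * Eliminating an unbounded quantifier *)

Section Elimination.
Variables (L : language) (T : theory L) (M : structure L) (A : set M).
Hypothesis T_distal : distal T.
Hypothesis M_T : models M T.
Hypothesis A_small : small A.
Hypothesis A_use : uniformly_stably_embedded A.
Hypothesis A_dnfcp : dnfcp' (Th (ind_structure A)).
Variables (a0 : M) (Aa0 : A a0).

Section Trace.
Variables (V Z : finType) (Phi : formula L (option V + Z)).

Definition realized (v : V -> M) :=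
  exists x, forall alpha, (forall z, A (alpha z)) -> sat (scat (oapp v x) alpha) Phi.

(* In contrast to the consistency of k formulas Phi(v, x, alpha), this quantifies
   over [A] only, up to the formula [exists x, theta(v, x, d)]. *)
Definition witnessed p (theta : formula L (option V + 'I_p)) k (v : V -> M) :=
  forall alpha : 'I_k -> Z -> M, (forall j z, A (alpha j z)) ->
  exists2 d : 'I_p -> M, forall i, A (d i) &
    (exists x, sat (scat (oapp v x) d) theta) /\
    forall j c, sat (scat c d) theta -> sat (scat c (alpha j)) Phi.

Definition implies p (theta : formula L (option V + 'I_p)) : formula L ('I_p + Z) :=
  AllF (Imp (rename (scat inl (inr \o inl)) theta)
            (rename (scat inl (inr \o inr)) Phi)).

Lemma sat_implies (N : structure L) p (theta : formula L (option V + 'I_p))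
    (d : 'I_p -> N) alpha :
  sat (scat d alpha) (implies theta) <->
  forall c, sat (scat c d) theta -> sat (scat c alpha) Phi.
Proof.
rewrite sat_AllF; split=> H c; move: (H c);
by rewrite /= !sat_rename !scat_comp.
Qed.

Definition proj p (theta : formula L (option V + 'I_p)) : formula L ('I_p + V) :=
  Ex (rename (scat (omap inr) (Some \o inl)) theta).

Lemma sat_proj p (theta : formula L (option V + 'I_p)) (d : 'I_p -> M) v :
  sat (scat d v) (proj theta) <-> exists x, sat (scat (oapp v x) d) theta.
Proof.
rewrite sat_Ex; split=> -[x Hx]; exists x; move: Hx;
by rewrite sat_rename; apply: iffLR; apply: sat_ext => -[[u|]|i].
Qed.

(** Stable embeddedness replaces [exists x, theta(v, x, d)] by a formula in d with parameters [e] in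
    [A]. Being witnessed is then a consistency statement in the induced structure. *)
Lemma witnessed_nfcp p (theta : formula L (option V + 'I_p)) :
  exists k, forall v, witnessed theta k v -> forall K, witnessed theta K v.
Proof.
have [q [chi Hchi]] := use_fin A_use (proj theta).
pose xi : formula L ('I_p + (Z + 'I_q)) :=
  And (rename (scat inl (inr \o inr)) chi)
      (rename (scat inl (inr \o inl)) (implies theta)).
have [k Hk] := nfcp_fin A_dnfcp Aa0 xi.
exists k => v wit K alpha Aalpha.
have [e Ae He] := Hchi v.
have xiE d al : (forall i, A (d i)) -> sat (scat d (scat al e)) xi <->
    (exists x, sat (scat (oapp v x) d) theta) /\
    forall c, sat (scat c d) theta -> sat (scat c al) Phi.
  move=> Ad; rewrite sat_And !sat_rename !scat_comp -sat_implies -sat_proj.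
  by rewrite (He d Ad).
(* One extra tuple ensures the existence of x even when [K] is 0. *)
have [||d Ad Hd] := Hk e Ae _ K.+1 (ocons (fun=> a0) alpha).
- move=> al Aal; have [d Ad [dv Hd]] := wit al Aal.
  by exists d => // j; apply/xiE => //; split=> //; exact: Hd.
- by move=> j z; rewrite /ocons; case: unlift => //= j'; exact: Aalpha.
exists d => //; split; first by have /xiE[] := Hd ord0.
by move=> j; have /(xiE _ _ Ad)[_] := Hd (lift ord0 j); rewrite oconsS.
Qed.

(** An x with [theta(v, x, d)] satisfies the finitely many given instances of [Phi]; smallness then
    realizes all instances at once. *)
Lemma witnessed_realized p (theta : formula L (option V + 'I_p)) v :
  (forall K, witnessed theta K v) -> realized v.
Proof.
move=> wit; apply: (small_fin A_small) => k alpha /(wit k)[d _ [[x Hx] Hd]].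
by exists x => j; exact: Hd.
Qed.

(** The quantifiers over x and c range over [M], but they lie inside the [L]-formula [E]; those over
    [alpha] and d range over [A]. *)
Lemma bounded_witnessed p (theta : formula L (option V + 'I_p)) k :
  bounded A (witnessed theta k).
Proof.
pose E : formula L ('I_p + ('I_k * Z + V)) :=
  And (rename (scat inl (inr \o inr)) (proj theta))
    (AndI (fun j => rename (scat inl (fun z => inr (inl (j, z)))) (implies theta))).
have := bounded_all (bounded_ex (bounded_sat A E)).
apply: bounded_ext => v.
have EE d al : sat (scat d (scat al v)) E <->
    (exists x, sat (scat (oapp v x) d) theta) /\
    forall j c, sat (scat c d) theta -> sat (scat c (fun z => al (j, z))) Phi.
  rewrite sat_And sat_rename scat_comp sat_proj sat_AndI.
  by split=> -[H1 H2]; split=> // j; move: (H2 j);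
     rewrite sat_rename scat_comp sat_implies.
split=> H al Aal.
  have [d Ad Hd] := H (fun j z => al (j, z)) (fun j z => Aal _).
  by exists d => //; apply/EE.
have [d Ad /EE Hd] := H (fun jz => al jz.1 jz.2) (fun jz => Aal _ _).
by exists d.
Qed.

(* If no finite list of formulas works, an ultrapower of (M, A) contains a tuple
   satisfying Phi over the ultrapower of A without a strong honest definition. *)
Lemma uniform_witness (kk : forall p, formula L (option V + 'I_p) -> nat) :
  exists r (t : 'I_r -> {p & formula L (option V + 'I_p)}), forall v,
  realized v -> exists i, witnessed (projT2 (t i)) (kk _ (projT2 (t i))) v.
Proof.
apply: contrapT => nfin.
(* The ultrapower is indexed by tuples c = (v, x); [B t] collects those where x realizes the trace
   over v although [t] does not witness it. *)
pose B (t : {p & formula L (option V + 'I_p)}) : set (option V -> M) :=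
  [set c | (forall alpha, (forall z, A (alpha z)) -> sat (scat c alpha) Phi) /\
    ~ witnessed (projT2 t) (kk _ (projT2 t)) (c \o Some)].
have [r t|U UU UB] := @ultra_of_fip _ _ B.
  have [v [x Hx] nw] : exists2 v, realized v &
      forall i, ~ witnessed (projT2 (t i)) (kk _ (projT2 (t i))) v.
    apply: contrapT => nv; apply: nfin; exists r, t => v rv.
    apply: contrapT => nw; apply: nv; exists v => // i wi.
    by apply: nw; exists i.
  by exists (oapp v x) => i; split; last exact: nw.
pose N := ultrapower M U; pose cl : _ -> N := uclass U.
have N_T : models N T by move=> s /M_T; exact: holds_ultrapower.
pose AN : set N := [set x | U [set c | A (urepr x c)]].
have AN_cl f : U [set c | A (f c)] -> AN (cl f).
  move=> Uf; apply: filterS (filterI Uf (urepr_class UU f)) => c /= [Af fc].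
  by rewrite -[X in A X]/(urepr (uclass U f) c) fc.
(* The generic tuple, represented by the coordinate functions. *)
pose c0 (z : option V) : N := cl (fun c => c z).
have [Z' [theta Htheta]] := good_distal AN T_distal N_T
  (rename (scat inl (inr \o @enum_rank Z)) Phi) c0.
have [p [theta' Htheta']] := finite_support theta.
have UBt := UB (existT _ p theta'); set k := kk p theta'.
(* At each c in [B], a family refuting [witnessed] is chosen; these represent a family [beta] in the
   ultrapower of [A], to which the definition of [c0] applies. *)
have /choice[al Hal] : forall c, exists al : 'I_k -> Z -> M,
    (forall j z, A (al j z)) /\ (B (existT _ p theta') c ->
    ~ exists2 d : 'I_p -> M, forall i, A (d i) &
    (exists x, sat (scat (oapp (c \o Some) x) d) theta') /\
    forall j c, sat (scat c d) theta' -> sat (scat c (al j)) Phi).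
  move=> c; have [[_ /existsNP[al /not_implyP[Aal nal]]]|nB] :=
    pselect (B (existT _ p theta') c); first by exists al; split.
  by exists (fun _ _ => a0); split.
pose beta (j : 'I_k) (z : Z) : N := cl (fun c => al c j z).
have scat_cl (X Y : Type) (f : X -> (option V -> M) -> M)
    (g : Y -> (option V -> M) -> M) :
    scat (fun x => cl (f x)) (fun y => cl (g y)) = fun t => cl (scat f g t).
  by apply: funext => -[].
have scat_at (X Y : Type) (f : X -> (option V -> M) -> M)
    (g : Y -> (option V -> M) -> M) c :
    (fun t => scat f g t c) = scat (fun x => f x c) (fun y => g y c).
  by apply: funext => -[].
have [|d0 [ANd0 c0d0 Hd0]] := Htheta k (fun j => beta j \o enum_val).
  move=> j; split=> [q|].
    by apply: AN_cl; apply: filterS filterT => c _; case: (Hal c) => Aal _; exact: Aal.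
  rewrite sat_rename scat_comp.
  have -> : scat c0 ((beta j \o enum_val) \o @enum_rank Z) = scat c0 (beta j).
    by apply: funext => -[//|z] /=; rewrite enum_rankK.
  rewrite scat_cl; apply/(sat_ultrapower UU); apply: filterS UBt => c [HPhi _] /=.
  by rewrite scat_at; apply: HPhi => z; case: (Hal c) => Aal _; exact: Aal.
(* The default value is the class of [a0], so that [d1] stays in [AN]. *)
have [d1 [d1d0 Hd1]] := Htheta' N (cl (fun=> a0)) d0.
have ANd1 i : AN (d1 i).
  case: (d1d0 i) => [->|[z ->]]; last exact: ANd0.
  by apply: AN_cl; apply: filterS filterT.
pose d i := urepr (d1 i).
have d1E : d1 = fun i => cl (d i) by apply: funext => i; rewrite /cl ureprK.
have Uc0 : U [set c | sat (scat c (fun i => d i c)) theta'].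
  have : sat (scat c0 d1) theta' by apply/Hd1.
  rewrite d1E scat_cl => /(sat_ultrapower UU); apply: filterS => c /=.
  by rewrite scat_at.
have Ubeta : U [set c | forall j x, sat (scat x (fun i => d i c)) theta' ->
    sat (scat x (al c j)) Phi].
  apply: (ultra_forall UU) => j.
  have : sat (scat d1 (beta j)) (implies theta').
    apply/sat_implies => x /Hd1 /(Hd0 j).
    rewrite sat_rename scat_comp; apply: iffLR; apply: sat_ext => -[//|z] /=.
    by rewrite enum_rankK.
  rewrite d1E scat_cl => /(sat_ultrapower UU); apply: filterS => c /=.
  by rewrite scat_at => /sat_implies.
have UAd : U [set c | forall i, A (d i c)] by exact: (ultra_forall UU).
(* By Łoś's theorem the properties of [d1] hold at some c of [B], contradicting the choice of
   [al c]. *)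
have [c [[[Bc Hc] Hb] Ad]] :=
  ultra_ex UU (filterI (filterI (filterI UBt Uc0) Ubeta) UAd).
case: (Hal c) => _ /(_ Bc); apply; exists (fun i => d i c) => //; split=> //.
exists (c None); apply: iffLR Hc; apply: sat_ext => -[[u|]|i] //.
Qed.

(** Being realized amounts to a finite disjunction of bounded conditions: one direction is
    [uniform_witness], the other dnfcp' followed by smallness. *)
Lemma bounded_realized : bounded A realized.
Proof.
have /choice[k0 Hk0] : forall t : {p & formula L (option V + 'I_p)}, exists k,
    forall v, witnessed (projT2 t) k v -> forall K, witnessed (projT2 t) K v.
  by move=> t; exact: witnessed_nfcp.
have [r [t Ht]] := uniform_witness (fun p theta => k0 (existT _ p theta)).
have := bounded_exists Aa0 (fun i => bounded_witnessed (projT2 (t i))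
  (k0 (existT _ _ (projT2 (t i))))).
apply: bounded_ext => v; split=> [/Ht //|[i wi]].
apply: (@witnessed_realized _ (projT2 (t i))).
by apply: Hk0; move: wi; case: (t i).
Qed.

End Trace.

(** Write [D(v, x)] as a prefix [Q] over [phi(alpha, v, x)]. The trace of [phi] on [A] is that of
    some [psi(alpha, b)] with b in [A], so x may be sought after b: [Q] is applied to [psi], and x
    need only make the two traces agree, which is an instance of [realized]. *)
Lemma bounded_Ex (V : finType) (D : (option V -> M) -> Prop) :
  bounded A D -> bounded A (fun v => exists x, D (oapp v x)).
Proof.
move=> /bounded_prenex[Z [phi [Q [DQ Qext Qbounded]]]].
have [q [psi Hpsi]] := use_fin A_use phi.
pose Phi : formula L (option (V + 'I_q) + Z) :=
  Iff (rename (scat inr (inl \o omap inl)) phi)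
      (rename (scat inr (inl \o Some \o inr)) psi).
have PhiE v b x al : sat (scat (oapp (scat v b) x) al) Phi <->
    (sat (scat al (oapp v x)) phi <-> sat (scat al b) psi).
  rewrite sat_Iff !sat_rename !scat_comp.
  have -> // : scat (oapp (scat v b) x) al \o (inl \o omap inl) = oapp v x.
  by apply: funext => -[].
pose swap : V + 'I_q -> 'I_q + V := scat inr inl.
have swapE (v : V -> M) (b : 'I_q -> M) : scat b v \o swap = scat v b.
  by apply: funext => -[].
have BQ := bounded_rename (@inl 'I_q V) (Qbounded _ _ (bounded_sat A psi)).
have BPhi := bounded_rename swap (bounded_realized Phi).
apply: bounded_ext (bounded_ex (bounded_and Aa0 BQ BPhi)) => v.
split=> [[x Dx]|[b Ab []]].
  have [b Ab Hb] := Hpsi (oapp v x).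
  exists b => //; split.
    by move: Dx; rewrite DQ; apply: iffLR; exact: Qext.
  by rewrite swapE; exists x => al Aal; apply/PhiE; exact: Hb.
rewrite swapE => HQ [x Hx]; exists x; move: HQ; rewrite DQ; apply: iffRL.
by apply: Qext => al Aal; apply/PhiE; exact: Hx.
Qed.

End Elimination.

(** * Induction on formulas of the pair language *)

Fixpoint term_lower L (V : Type) (t : term (pair_language L) V) : term L V :=
  match t with
  | Var x => Var x
  | App f ts => @App L V f (fun i => term_lower (ts i))
  end.

Section Lower.
Variables (L : language) (M : structure L) (A : set M).
Let PM := pair_structure A.

Lemma eval_lower (V : Type) (v : V -> M) (t : term (pair_language L) V) :
  eval (M := PM) v t = eval v (term_lower t).
Proof. by elim: t => //= f ts IH; congr finterp; apply: funext. Qed.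

Lemma sat_Eql_lower (V : Type) (v : V -> M) (s t : term (pair_language L) V) :
  sat (M := PM) v (Eql s t) <-> sat v (Eql (term_lower s) (term_lower t)).
Proof. by rewrite /= !eval_lower. Qed.

Lemma sat_Rel_lower (V : Type) (v : V -> M) (r : rel_sym L)
    (ts : 'I_(rarity r) -> term (pair_language L) V) :
  sat (M := PM) v (@Rel (pair_language L) V (Some r) ts) <->
  sat v (Rel r (fun i => term_lower (ts i))).
Proof.
move=> /=; suff -> : (fun i => eval (M := PM) v (ts i)) =
  (fun i => eval v (term_lower (ts i))) by [].
by apply: funext => i; rewrite eval_lower.
Qed.

(** For empty [A] the predicate can be replaced by [Bot]. This case is separate because the Boolean
    closure of bounded sets was proved from an element of [A]. *)
Lemma sat_empty_lower : A = set0 -> forall (V : Type) (phi : formula (pair_language L) V),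
  exists phi' : formula L V, forall v : V -> M, sat (M := PM) v phi <-> sat v phi'.
Proof.
move=> A0 V; elim=> {V} [V|V s t|V [r|] ts|V p [p' Hp] q [q' Hq]|V p [p' Hp]].
- by exists Bot.
- by eexists => v; exact: sat_Eql_lower.
- by eexists => v; exact: sat_Rel_lower.
- by exists Bot => v /=; rewrite A0.
- by exists (Imp p' q') => v /=; rewrite Hp Hq.
- by exists (All p') => v /=; split=> H x; apply/Hp; exact: H.
Qed.

End Lower.

(** The equivalence of two formulas is a single sentence, so it passes from (M, A) to all models of
    its theory. *)
Lemma P_bounded_of_bounded L (M : structure L) (A : set M) :
  (forall n (phi : formula (pair_language L) 'I_n),
     bounded A (fun v => sat (M := pair_structure A) v phi)) ->
  P_bounded (Th (pair_structure A)).
Proof.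
move=> H n phi; have [psi Bpsi Hpsi] := H n phi.
exists psi => // N NT v.
have : holds (pair_structure A) (AllI (rename (@inl 'I_n void) (Iff phi psi))).
  by apply/sat_AllI => w; rewrite sat_rename sat_Iff; exact: Hpsi.
by move=> /NT /sat_AllI /(_ v); rewrite sat_rename sat_Iff.
Qed.

Theorem theorem43 (L : language) (T : theory L) (M : structure L) (A : set M)
    (T_distal : distal T) (M_T : models M T) (A_small : small A)
    (A_use : uniformly_stably_embedded A)
    (A_dnfcp : dnfcp' (Th (ind_structure A))) :
  P_bounded (Th (pair_structure A)).
Proof.
apply: P_bounded_of_bounded => n phi.
have [A0|/eqP/set0P[a0 Aa0]] := pselect (A = set0).
  have [phi' Hphi'] := sat_empty_lower A0 phi.
  exact: bounded_ext (bounded_sat A phi').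
(* The induction runs over formulas with arbitrary variable types, while [bounded_Ex] needs a finite
   one; hence the renaming [f] into [W]. *)
suff H (V : Type) (psi : formula (pair_language L) V) (W : finType) (f : V -> W) :
    bounded A (fun w => sat (M := pair_structure A) (w \o f) psi).
  exact: (H _ phi _ id).
elim: psi W f => {V} [V|V s t|V [r|] ts|V p IHp q IHq|V p IH] W f.
- exact: (bounded_sat A Bot).
- have := bounded_sat A (Eql (term_lower s) (term_lower t)).
  move=> /(bounded_rename f); apply: bounded_ext => w.
  exact: sat_Eql_lower.
- have := bounded_sat A (Rel r (fun i => term_lower (ts i))).
  move=> /(bounded_rename f); apply: bounded_ext => w.
  exact: sat_Rel_lower.
(* [P(t)] is rewritten as: some x in [A] equals t. *)
- have := bounded_ex1
    (bounded_sat A (Eql (Var None) (rename_term Some (term_lower (ts ord0))))).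
  move=> /(bounded_rename f); apply: bounded_ext => w /=.
  rewrite eval_lower; split=> [At|[x Ax]].
    by exists (eval (w \o f) (term_lower (ts ord0))); rewrite ?eval_rename.
  by rewrite eval_rename => <-.
- exact: (bounded_imp Aa0 (IHp _ f) (IHq _ f)).
- have := bounded_Ex T_distal M_T A_small A_use A_dnfcp Aa0
    (bounded_not Aa0 (IH _ (omap f))).
  move=> /(bounded_not Aa0); apply: bounded_ext => w /=.
  have E x : sat (M := pair_structure A) (oapp w x \o omap f) p <->
      sat (M := pair_structure A) (oapp (w \o f) x) p.
    by apply: sat_ext; case.
  split=> [H [x]|H x]; first by rewrite E; apply.
  by apply: contrapT => nH; apply: H; exists x; rewrite E.
Qed.
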